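(* Let $D$ be an infinite integral domain such that, for every $t$-maximal ideal $\mathfrak{p}$ of $D$ with finite residue field, $\mathfrak{p}D_{\mathfrak{p}}$ is principal and $\operatorname{Int}(D_{\mathfrak{p}}) = \operatorname{Int}(D)_{\mathfrak{p}}$. (This hypothesis holds, for example, if $D$ is an infinite TV PVMD, or more generally if $D$ is an infinite H PVMD such that $\operatorname{Int}(D_{\mathfrak{p}}) = \operatorname{Int}(D)_{\mathfrak{p}}$ for all prime ideals $\mathfrak{p}$ of $D$.) Then the following hold. (a) $\operatorname{Int}(D)$ is locally free as a $D$-module. (b) $\operatorname{Int}(S^{-1}D) = S^{-1}\operatorname{Int}(D)$ for every multiplicative subset $S$ of $D$. (c) Every $t$-linked extension of $D$ is polynomially regular. (d) A $t$-linked extension of $D$ is polynomially complete if and only if it is unramified and has trivial residue field extensions at every $t$-maximal ideal of $D$ with finite residue field.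
   Context: Extensions $A \supset D$ are extensions of integral domains ($A$ is not necessarily contained in the quotient field of $D$). For an integral domain $A$ with quotient field $L$ and a subset $E \subset L$, $\operatorname{Int}(E,A) = \{f(X) \in L[X] : f(E) \subset A\}$, and $\operatorname{Int}(A) = \operatorname{Int}(A,A)$; in particular, for $A \supset D$, $\operatorname{Int}(D,A)=\{f \in L[X] : f(D)\subset A\}$ with $L$ the quotient field of $A$. For a prime $\mathfrak{p}$ of $D$ and a $D$-module $M$, $M_{\mathfrak{p}} = (D\setminus\mathfrak{p})^{-1}M$. The residue field of $\mathfrak{p}$ is $\kappa(\mathfrak{p}) = D_{\mathfrak{p}}/\mathfrak{p}D_{\mathfrak{p}}$. A $D$-module $M$ is locally free if $M_{\mathfrak{p}}$ is a free $D_{\mathfrak{p}}$-module for every prime ideal $\mathfrak{p}$ of $D$. Multiplicative subsets do not contain $0$. Let $D$ be a domain with quotient field $K$. A fractional ideal is a $D$-submodule $I$ of $K$ with $dI\subset D$ for some nonzero $d \in D$; $I^{-1} = \{x \in K : xI \subset D\}$, $I_v = (I^{-1})^{-1}$, and $I_t = \bigcup J_v$, where $J$ ranges over the nonzero finitely generated fractional ideals contained in $I$. A $t$-ideal (resp. $v$-ideal) is a nonzero fractional ideal $I$ with $I = I_t$ (resp. $I=I_v$). A $t$-maximal ideal is an ideal maximal among the $t$-ideals properly contained in $D$ (such ideals are prime). A nonzero ideal $I$ is $t$-invertible if $(I^{-1}I)_t = D$ and $v$-invertible if $(I^{-1}I)_v = D$. $D$ is a TV domain if every $t$-ideal is a $v$-ideal;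 an H domain if every $v$-invertible ideal is $t$-invertible; a PVMD (Prüfer $v$-multiplication domain) if every nonzero finitely generated ideal is $t$-invertible. A TV PVMD (resp. H PVMD) is a PVMD that is a TV domain (resp. H domain). An extension $A \supset D$ is $t$-linked if $I_t = D$ implies $(IA)_t = A$ for every nonzero ideal $I$ of $D$ (the second $t$-closure being taken in $A$). It is polynomially regular if $\operatorname{Int}(D,A)$ is generated by $\operatorname{Int}(D)$ as an $A$-module. It is polynomially complete if $\operatorname{Int}(D,A) = \operatorname{Int}(A)$. It is unramified at a prime $\mathfrak{p}$ of $D$ if for every prime $\mathfrak{q}$ of $A$ lying over $\mathfrak{p}$ one has $\mathfrak{p}A_{\mathfrak{q}} = \mathfrak{q}A_{\mathfrak{q}}$ and $\kappa(\mathfrak{q}) = A_{\mathfrak{q}}/\mathfrak{q}A_{\mathfrak{q}}$ is a finite separable field extension of $\kappa(\mathfrak{p})$. It has trivial residue field extensions at $\mathfrak{p}$ if $\kappa(\mathfrak{q}) = \kappa(\mathfrak{p})$ for every prime $\mathfrak{q}$ of $A$ lying over $\mathfrak{p}$. *)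

(* Defs.v *)
From HB Require Import structures.
From mathcomp Require Import all_boot all_algebra all_field.
From mathcomp Require Import all_classical.

Set Implicit Arguments.
Unset Strict Implicit.
Unset Printing Implicit Defensive.

Import GRing.Theory.
Local Open Scope classical_set_scope.
Local Open Scope ring_scope.

Notation "x %:F" := (@FracField.tofrac _ x).

Section Modules.
Variables (K : fieldType) (V : lmodType K).

(* The R-submodule of V generated by X, for R a subring of K. *)
Definition span (R : set K) (X : set V) : set V :=
  [set v | exists2 s : seq (K * V),
     (forall c, c \in s -> R c.1 /\ X c.2) & v = \sum_(c <- s) c.1 *: c.2].

(* M is a free R-module: it has a basis B. *)
Definition free_module (R : set K) (M : set V) : Prop :=
  exists B : set V,
    [/\ B `<=` M, span R B = M &
        forall (s : seq V) (c : V -> K), uniq s ->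
          (forall v, v \in s -> B v /\ R (c v)) ->
          \sum_(v <- s) c v *: v = 0 -> forall v, v \in s -> c v = 0].

End Modules.

(* The subset Int(E, A) of L[X], for E and A contained in the field L. *)
Definition Int (L : fieldType) (E A : set L) : set {poly L} :=
  [set f | forall x, E x -> A f.[x]].

Section Domain.
Variable D : idomainType.
Local Notation K := {fraction D}.

Definition dom : set K := range (fun a : D => a%:F).

(* The ideal p, viewed inside the quotient field of D. *)
Definition dom_ideal (p : {pred D}) : set K :=
  (fun a : D => a%:F) @` [set a | a \in p].

Definition mult_subset (S : set D) : Prop :=
  [/\ S 1, forall s t, S s -> S t -> S (s * t) & ~ S 0].

(* The modules localized here are D-submodules M of a K-vector space V; they
   are torsion-free, so that S^-1 M is the set of all m / s inside V.         *)
Definition localize (V : lmodType K) (S : set D) (M : set V) : set V :=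
  [set v | exists s m, [/\ S s, M m & v = (s%:F)^-1 *: m]].

Definition dom_loc (S : set D) : set K := @localize K^o S dom.

Definition compl (p : {pred D}) : set D := [set s | s \notin p].

Definition dom_at (p : {pred D}) : set K := dom_loc (compl p).

Definition locally_free (V : lmodType K) (M : set V) : Prop :=
  forall p : prime_idealr D, free_module (dom_at p) (localize (compl p) M).

Definition submodule (I : set K) : Prop :=
  [/\ I 0, forall x y, I x -> I y -> I (x + y) &
      forall a x, I x -> I (a%:F * x)].

Definition nonzero (I : set K) : Prop := exists2 x, I x & x != 0.

Definition frac_ideal (I : set K) : Prop :=
  submodule I /\ exists2 d : D, d != 0 & forall x, I x -> dom (d%:F * x).

Definition ideal (I : set K) : Prop := submodule I /\ I `<=` dom.

Definition fin_gen (I : set K) : Prop :=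
  exists s : seq K, I = @span K K^o dom [set` s].

Definition ideal_inv (I : set K) : set K :=
  [set x | forall y, I y -> dom (x * y)].

Definition ideal_prod (I J : set K) : set K :=
  @span K K^o dom [set z | exists x y, [/\ I x, J y & z = x * y]].

Definition vclosure (I : set K) : set K := ideal_inv (ideal_inv I).

Definition tclosure (I : set K) : set K :=
  [set x | exists J, [/\ nonzero J, fin_gen J, frac_ideal J, J `<=` I
                       & vclosure J x]].

Definition v_ideal (I : set K) : Prop :=
  [/\ nonzero I, frac_ideal I & I = vclosure I].

Definition t_ideal (I : set K) : Prop :=
  [/\ nonzero I, frac_ideal I & I = tclosure I].

Definition proper_t_ideal (I : set K) : Prop :=
  [/\ t_ideal I, I `<=` dom & I <> dom].

Definition t_maximal (I : set K) : Prop :=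
  proper_t_ideal I /\ forall J, proper_t_ideal J -> I `<=` J -> J = I.

Definition v_invertible (I : set K) : Prop :=
  vclosure (ideal_prod (ideal_inv I) I) = dom.

Definition t_invertible (I : set K) : Prop :=
  tclosure (ideal_prod (ideal_inv I) I) = dom.

Definition TV_domain : Prop := forall I, t_ideal I -> v_ideal I.

Definition H_domain : Prop :=
  forall I, ideal I -> nonzero I -> v_invertible I -> t_invertible I.

Definition PVMD : Prop :=
  forall I, ideal I -> nonzero I -> fin_gen I -> t_invertible I.

Definition TV_PVMD : Prop := PVMD /\ TV_domain.

Definition H_PVMD : Prop := PVMD /\ H_domain.

Definition IntD : set {poly K} := Int dom dom.

Definition Int_commutes_loc (S : set D) : Prop :=
  Int (dom_loc S) (dom_loc S) = localize S IntD.

End Domain.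

Arguments dom : clear implicits.
Arguments IntD : clear implicits.

Section ResidueField.
Variables (D : idomainType) (p : prime_idealr D).
Local Notation K := {fraction D}.

(* The local ring D_p, as a subring of the quotient field of D. *)
Definition local_pred : {pred K} := fun x => `[< dom_at p x >].

Record local_ring := LocalRing { local_val : K; _ : local_val \in local_pred }.

HB.instance Definition _ := [isSub for local_val].
HB.instance Definition _ := [Choice of local_ring by <:].

Lemma dom_atP x : reflect (exists a s : D, s \notin p /\ x = a%:F / s%:F)
                          (x \in local_pred).
Proof.
apply: (iffP (asboolP _)) => [[s [_ [sp [a _ <-] ->]]]|[a [s [sp ->]]]].
  by exists a, s; split => //; rewrite mulrC.
by exists s, a%:F; split=> //; [exists a|rewrite mulrC].
Qed.

Lemma compl_prime_neq0 s : s \notin p -> s%:F != 0 :> K.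
Proof. by rewrite tofrac_eq0; apply: contraNneq => ->; rewrite rpred0. Qed.

Lemma local_subring : subring_closed local_pred.
Proof.
have prM s t : s \notin p -> t \notin p -> s * t \notin p.
  by rewrite prime_idealrM negb_or => -> ->.
split.
- by apply/dom_atP; exists 1, 1; rewrite idealr1 /= tofrac1 divr1.
- move=> _ _ /dom_atP[a [s [sp ->]]] /dom_atP[b [t [tp ->]]].
  apply/dom_atP; exists (a * t - b * s), (s * t); split; first exact: prM.
  have s0 := compl_prime_neq0 sp; have t0 := compl_prime_neq0 tp.
  by rewrite tofracB !tofracM -mulNr addf_div // mulNr.
- move=> _ _ /dom_atP[a [s [sp ->]]] /dom_atP[b [t [tp ->]]].
  apply/dom_atP; exists (a * b), (s * t); split; first exact: prM.
  by rewrite !tofracM mulf_div.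
Qed.

HB.instance Definition _ := GRing.isSubringClosed.Build K local_pred
  local_subring.
HB.instance Definition _ :=
  [SubChoice_isSubComNzRing of local_ring by <:].

(* The ideal pD_p of D_p generated by p. *)
Definition max_set : set K := @span K K^o (dom_at p) (dom_ideal p).

Definition max_pred : {pred local_ring} := fun x => `[< max_set (val x) >].

Lemma max_setP x : max_set x <->
  exists a s : D, [/\ a \in p, s \notin p & x = a%:F / s%:F].
Proof.
split=> [[l lP ->]|[a [s [ap sp ->]]]]; last first.
  exists [:: (s%:F^-1, a%:F)] => [c|]; last by rewrite big_seq1 mulrC.
  rewrite inE => /eqP ->; split; last by exists a.
  by apply/asboolP/dom_atP; exists 1, s; rewrite tofrac1 mul1r.
elim: l lP => [|c l IHl] lP.
  by exists 0, 1; rewrite big_nil rpred0 idealr1 tofrac0 mul0r.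
rewrite big_cons; have [|b [t [bp tp ->]]] := IHl.
  by move=> d dl; apply: lP; rewrite inE dl orbT.
have [/asboolP/dom_atP[a [s [sp c1]]] [d dp c2]] := lP c (mem_head _ _).
exists (a * d * t + b * s), (s * t); split.
- by rewrite rpredD // ?[_ * t]mulrC ?[b * s]mulrC idealMr // idealMr.
- by rewrite prime_idealrM negb_or sp.
- have s0 := compl_prime_neq0 sp; have t0 := compl_prime_neq0 tp.
  by rewrite c1 -c2 tofracD !tofracM /= /GRing.scale /= mulrAC addf_div.
Qed.

Lemma mem_max_pred x : (x \in max_pred) = `[< max_set (val x) >].
Proof. by []. Qed.

Lemma max_idealr : idealr_closed max_pred.
Proof.
split.
- rewrite mem_max_pred; apply/asboolP/max_setP.
  by exists 0, 1; rewrite rpred0 idealr1 tofrac0 mul0r.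
- rewrite mem_max_pred; apply/asboolP => /max_setP[a [s [ap sp]]].
  have s0 := compl_prime_neq0 sp; rewrite rmorph1 => e.
  have /eqP : s%:F = a%:F :> K by rewrite -[RHS](divfK s0) -e mul1r.
  by rewrite tofrac_eq => /eqP sa; rewrite sa ap in sp.
- move=> x y z; rewrite !mem_max_pred.
  move=> /asboolP/max_setP[a [s [ap sp yE]]].
  move=> /asboolP/max_setP[b [t [bp tp zE]]].
  have /dom_atP[c [u [up xE]]] := valP x.
  have s0 := compl_prime_neq0 sp; have t0 := compl_prime_neq0 tp.
  have u0 := compl_prime_neq0 up.
  apply/asboolP/max_setP; exists (c * a * t + b * (u * s)), (u * s * t); split.
  + by rewrite rpredD // ?[_ * t]mulrC ?[b * _]mulrC idealMr // idealMr.
  + by rewrite !prime_idealrM !negb_or up sp.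
  + rewrite rmorphD rmorphM /= yE zE; move: xE; rewrite /= => ->.
    by rewrite tofracD !tofracM mulf_div addf_div // mulf_neq0.
Qed.

HB.instance Definition _ := isIdealr.Build local_ring max_pred max_idealr.

Definition residue_field := {ideal_quot max_pred}.

HB.instance Definition _ := GRing.ComNzRing.on residue_field.
HB.instance Definition _ := EqQuotient.on residue_field.

Definition residue_class (x : local_ring) : residue_field :=
  (\pi_(residue_field) x)%qT.

Definition residue_inv (x : residue_field) : residue_field :=
  residue_class (insubd 0 (val (repr x))^-1).

Lemma residue_class_eq x y :
  (residue_class x == residue_class y) = (x - y \in max_pred).
Proof. by rewrite Quotient.idealrBE. Qed.

Lemma residue_classK (x : residue_field) : residue_class (repr x) = x.
Proof. exact: reprK. Qed.

Lemma residue_class_is_zmod_morphism : zmod_morphism residue_class.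
Proof. exact: rmorphB. Qed.

Lemma residue_class_is_monoid_morphism : monoid_morphism residue_class.
Proof. by split; [exact: rmorph1|exact: rmorphM]. Qed.

HB.instance Definition _ := GRing.isZmodMorphism.Build local_ring residue_field
  residue_class residue_class_is_zmod_morphism.
HB.instance Definition _ := GRing.isMonoidMorphism.Build local_ring
  residue_field residue_class residue_class_is_monoid_morphism.

Lemma residue_class_eq0 x : (residue_class x == 0) = (x \in max_pred).
Proof. by rewrite -(rmorph0 residue_class) residue_class_eq subr0. Qed.

Lemma residue_mulVf (x : residue_field) : x != 0 -> residue_inv x * x = 1.
Proof.
rewrite -{1 3}[x]residue_classK residue_class_eq0 /residue_inv.
move: (repr x) => r rm; have /dom_atP[a [s [sp rE]]] := valP r.
have ap : a \notin p.
  by apply: contra rm => ap; apply/asboolP/max_setP; exists a, s.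
have rV : (val r)^-1 \in local_pred.
  by apply/dom_atP; exists s, a; split; rewrite // rE invf_div.
rewrite -rmorphM -(rmorph1 residue_class); congr residue_class.
apply: val_inj; rewrite rmorphM rmorph1 /= insubdK // mulVf // rE.
by rewrite mulf_neq0 ?invr_eq0 // compl_prime_neq0.
Qed.

Lemma residue_inv0 : residue_inv 0 = 0.
Proof.
have := residue_classK 0; rewrite /residue_inv.
move: (repr _) => r /eqP; rewrite residue_class_eq0 => /asboolP.
move=> /max_setP[a [s [ap sp rE]]]; rewrite /insubd.
case: insubP => [y _ yE|]; last by rewrite rmorph0.
have [a0|a0] := eqVneq a 0.
  suff -> : y = 0 by exact: rmorph0.
  by apply: val_inj; rewrite yE rE a0 tofrac0 mul0r invr0 rmorph0.
have /dom_atP[b [t [tp]]] := valP y; rewrite yE rE invf_div => /eqP.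
rewrite eqr_div ?tofrac_eq0 //; last by rewrite -tofrac_eq0 compl_prime_neq0.
rewrite -!tofracM tofrac_eq => /eqP e.
have : s * t \notin p by rewrite prime_idealrM negb_or sp.
by rewrite e idealMr.
Qed.

HB.instance Definition _ := GRing.ComNzRing_isField.Build residue_field
  residue_mulVf residue_inv0.

End ResidueField.

Definition finite_residue (D : idomainType) (p : prime_idealr D) : Prop :=
  finite_set [set: residue_field p].

(* t-maximal ideals are prime, so they are exactly the primes p of the library
   such that t_maximal (dom_ideal p).                                         *)
Definition standing_hyp (D : idomainType) : Prop :=
  forall p : prime_idealr D,
    t_maximal (dom_ideal p) -> finite_residue p ->
    (exists a, max_set p = @span _ {fraction D}^o (dom_at p) [set a]) /\
    Int_commutes_loc (compl p).

Definition finite_separable (F E : fieldType) (f : {rmorphism F -> E}) : Prop :=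
  (exists s : seq E, forall y, exists c : E -> F,
     y = \sum_(x <- s) f (c x) * x) /\
  (forall y : E, exists g : {poly F},
     [/\ irreducible_poly g, separable_poly g & root (map_poly f g) y]).

Section FracMap.
Variables (D A : idomainType) (phi : {rmorphism D -> A}).
Local Notation K := {fraction D}.
Local Notation L := {fraction A}.

(* An extension of D is an injective ring morphism phi : D -> A; frac_map is the
   induced embedding of quotient fields.                                      *)
Definition frac_map (phi_inj : injective phi) (x : K) : L :=
  (phi \n_(repr x))%:F / (phi \d_(repr x))%:F.

Variable phi_inj : injective phi.

Lemma frac_repr (x : K) : x = (\n_(repr x))%:F / (\d_(repr x))%:F.
Proof.
apply: (canRL (mulfK _)); first by rewrite tofrac_eq0 denom_ratioP.
rewrite -{1}[x]reprK; move: (repr x) => [[n d] /= d0].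
rewrite !piE; apply/eqmodP => /=.
rewrite /equivf /FracField.mulf !numden_Ratio ?oner_eq0 ?mulr1 ?mulf_neq0 //=.
by rewrite mulrC.
Qed.

Lemma frac_mapE a s : s != 0 ->
  frac_map phi_inj (a%:F / s%:F) = (phi a)%:F / (phi s)%:F.
Proof.
move=> s0; rewrite /frac_map; set x := a%:F / s%:F.
have phi0 (t : D) : t != 0 -> (phi t)%:F != 0 :> L.
  by rewrite tofrac_eq0 -(rmorph0 phi) (inj_eq phi_inj).
have := frac_repr x; rewrite {1}/x; move: (repr x) => [[n d] /= d0] /eqP.
rewrite eqr_div ?tofrac_eq0 // -!tofracM tofrac_eq => /eqP e.
by apply/eqP; rewrite eqr_div ?phi0 // -!tofracM -!rmorphM e.
Qed.

Lemma frac_map_tofrac a : frac_map phi_inj a%:F = (phi a)%:F.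
Proof.
by have := frac_mapE a (oner_neq0 D); rewrite !rmorph1 !divr1.
Qed.

Lemma frac_map_is_zmod_morphism : zmod_morphism (frac_map phi_inj).
Proof.
have phi0 (t : D) : t != 0 -> (phi t)%:F != 0 :> L.
  by rewrite tofrac_eq0 -(rmorph0 phi) (inj_eq phi_inj).
move=> x y; rewrite [x]frac_repr [y]frac_repr.
move: (repr x) (repr y) => [[n d] /= d0] [[m e] /= e0].
rewrite -mulNr addf_div ?tofrac_eq0 // -tofracN -!tofracM -tofracD.
rewrite !frac_mapE ?mulf_neq0 // rmorphD !rmorphM rmorphN.
by rewrite -mulNr addf_div ?phi0 // -tofracN -!tofracM -tofracD.
Qed.

Lemma frac_map_is_monoid_morphism : monoid_morphism (frac_map phi_inj).
Proof.
split; first by rewrite -tofrac1 frac_map_tofrac rmorph1.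
move=> x y; rewrite [x]frac_repr [y]frac_repr.
move: (repr x) (repr y) => [[n d] /= d0] [[m e] /= e0].
rewrite mulf_div -!tofracM !frac_mapE ?mulf_neq0 // !rmorphM.
by rewrite mulf_div -!tofracM.
Qed.

HB.instance Definition _ := GRing.isZmodMorphism.Build K L
  (frac_map phi_inj) frac_map_is_zmod_morphism.
HB.instance Definition _ := GRing.isMonoidMorphism.Build K L
  (frac_map phi_inj) frac_map_is_monoid_morphism.

End FracMap.

Section Extension.
Variables (D A : idomainType) (phi : {rmorphism D -> A}).
Variable phi_inj : injective phi.
Local Notation K := {fraction D}.
Local Notation L := {fraction A}.
Local Notation iota := (frac_map phi_inj).

Definition lies_over (q : {pred A}) (p : {pred D}) : Prop :=
  forall a : D, (phi a \in q) = (a \in p).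

Section ResidueMap.
Variables (p : prime_idealr D) (q : prime_idealr A).
Variable qp : lies_over q p.

Lemma local_map_subproof (x : local_ring p) : iota (val x) \in local_pred q.
Proof.
have /dom_atP[a [s [sp ->]]] := valP x.
have s0 : s != 0 by rewrite -tofrac_eq0 (compl_prime_neq0 sp).
by apply/dom_atP; exists (phi a), (phi s); rewrite qp frac_mapE.
Qed.

Definition local_map (x : local_ring p) : local_ring q :=
  LocalRing (local_map_subproof x).

Definition residue_map (x : residue_field p) : residue_field q :=
  residue_class (local_map (repr x)).

Lemma local_map_is_zmod_morphism : zmod_morphism local_map.
Proof.
move=> x y; apply: val_inj; rewrite [RHS]rmorphB.
by rewrite -[LHS]/(iota (val (x - y))) !rmorphB.
Qed.

Lemma local_map_is_monoid_morphism : monoid_morphism local_map.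
Proof.
split=> [|x y]; apply: val_inj.
  by rewrite -[LHS]/(iota (val 1)) !rmorph1.
by rewrite [RHS]rmorphM -[LHS]/(iota (val (x * y))) !rmorphM.
Qed.

HB.instance Definition _ := GRing.isZmodMorphism.Build (local_ring p)
  (local_ring q) local_map local_map_is_zmod_morphism.
HB.instance Definition _ := GRing.isMonoidMorphism.Build (local_ring p)
  (local_ring q) local_map local_map_is_monoid_morphism.

Lemma residue_mapE x :
  residue_map (residue_class x) = residue_class (local_map x).
Proof.
apply/eqP; rewrite residue_class_eq -rmorphB; set y := repr _ - x.
have /asboolP/max_setP[a [s [ap sp yE]]] : y \in @max_pred D p.
  by rewrite -residue_class_eq residue_classK.
have s0 : s != 0 by rewrite -tofrac_eq0 (compl_prime_neq0 sp).
apply/asboolP/max_setP; exists (phi a), (phi s).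
by rewrite !qp; split => //=; rewrite -frac_mapE // -yE.
Qed.

Lemma residue_map_is_zmod_morphism : zmod_morphism residue_map.
Proof.
move=> x y; rewrite -[x]residue_classK -[y]residue_classK.
by rewrite -rmorphB !residue_mapE !rmorphB.
Qed.

Lemma residue_map_is_monoid_morphism : monoid_morphism residue_map.
Proof.
split=> [|x y].
  by rewrite -(rmorph1 (@residue_class _ p)) residue_mapE !rmorph1.
rewrite -[x]residue_classK -[y]residue_classK.
by rewrite -rmorphM !residue_mapE !rmorphM.
Qed.

HB.instance Definition _ := GRing.isZmodMorphism.Build (residue_field p)
  (residue_field q) residue_map residue_map_is_zmod_morphism.
HB.instance Definition _ := GRing.isMonoidMorphism.Build (residue_field p)
  (residue_field q) residue_map residue_map_is_monoid_morphism.

End ResidueMap.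

Definition t_linked : Prop :=
  forall I : set K, ideal I -> nonzero I -> tclosure I = dom D ->
    tclosure (@span L L^o (dom A) (iota @` I)) = dom A.

Definition Int_ext : set {poly L} := Int (iota @` dom D) (dom A).

Definition polynomially_regular : Prop :=
  Int_ext = span (dom A) (map_poly iota @` IntD D).

Definition polynomially_complete : Prop := Int_ext = IntD A.

Definition unramified_at (p : prime_idealr D) : Prop :=
  forall (q : prime_idealr A) (qp : lies_over q p),
    @span L L^o (dom_at q) (iota @` dom_ideal p) = max_set q /\
    finite_separable (residue_map qp).

Definition trivial_residue_at (p : prime_idealr D) : Prop :=
  forall (q : prime_idealr A) (qp : lies_over q p),
    bijective (residue_map qp).

End Extension.

(* Main.v *)
(* For a prime p of D, either D/p is infinite, or p contains a finite set J with
   J^-1 = D, or p is t-maximal with finite residue field.  In the first two cases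
   Vandermonde determinants in distinct residues mod p, respectively in the powers
   of the elements of J, show that Int(D, A) becomes contained in A[X] after
   inverting elements outside p.  In the last case D_p has a uniformizer pi and a
   finite residue field, and the base-q expansions u_n in powers of pi give Newton
   polynomials prod_(k < n) (X - u_k) / (u_n - u_k) which form a basis of
   Int(D_p) = Int(D)_p over D_p; these polynomials remain integer-valued over every
   overring in which pi and the same residues still exhaust the ring.
   Global statements follow because the multipliers of a given element into a
   module form an ideal, which is contained in some prime unless it is the whole
   ring.  For (d), the polynomial prod_s (X - a_s) / pi, over a system a_s of
   residues, detects both ramification and residue field growth.  If D is a TV
   domain, every nonzero element lies in finitely many t-maximal ideals. *)

Require Import Defs.
From HB Require Import structures.
From mathcomp Require Import all_boot all_algebra all_field.
From mathcomp Require Import all_classical.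
From mathcomp Require Import ring.
Import GRing.Theory.
Local Open Scope classical_set_scope.
Local Open Scope ring_scope.

Set Implicit Arguments.
Unset Strict Implicit.
Unset Printing Implicit Defensive.

(* The span of Defs, which is shadowed by that of vector spaces *)
Local Notation span := Defs.span.

(** * Spans, prime ideals and their residues *)

(** Parts (b), (c) and one direction of (d) rest on the single statement [Int_over_span]: if finite
    sets [J] with J_v = D remain dense for a ring [B] over [D], then every polynomial taking [D]
    into [B] lies in the [B]-span of Int(D). The record [t_linked_over] is shaped so that [D]
    itself, every S^-1 D and every t-linked [A] are instances. The obstacle at a t-maximal [p] with
    finite residue field is that a principal pD_p does not make D_p a discrete valuation ring: the
    powers of [pi] may have a nonzero common multiple. No valuation is available to compare
    numerators with denominators, so the powers of [pi] are cancelled explicitly, by a recursion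
    from [n] to [n %/ q] on base-q digits. The powers of an element [a] of [p] are good Vandermonde
    nodes because a^j - a^i is a^i times an element congruent to -1 modulo [p]; the leftover powers
    of the various [a] in [J] are then removed together by density of [J]. *)

Section Spans.
Variables (K : fieldType) (V : lmodType K).
Implicit Types (R : set K) (M X : set V).

Definition is_submod R M : Prop :=
  [/\ M 0, forall u v, M u -> M v -> M (u + v)
    & forall c v, R c -> M v -> M (c *: v)].

Lemma span_is_submod R X :
  (forall c d, R c -> R d -> R (c * d)) -> is_submod R (span R X).
Proof.
move=> RM; split=> [|_ _ [s sP ->] [t tP ->]|a _ Ra [s sP ->]].
- by exists [::] => //; rewrite big_nil.
- exists (s ++ t); last by rewrite big_cat.
  by move=> c; rewrite mem_cat => /orP[/sP|/tP].
- exists [seq (a * c.1, c.2) | c <- s].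
    by move=> _ /mapP[c /sP[Rc Xc] ->]; split=> //=; apply: RM.
  by rewrite big_map scaler_sumr; apply: eq_bigr => c _; rewrite scalerA.
Qed.

Lemma span_min R X M : is_submod R M -> X `<=` M -> span R X `<=` M.
Proof.
move=> [M0 MD MZ] XM _ [s sP ->]; rewrite big_seq.
by apply: (big_ind M) => // c /sP[Rc /XM]; apply: MZ.
Qed.

Lemma span_gen R X : R 1 -> X `<=` span R X.
Proof.
move=> R1 v Xv; exists [:: (1, v)]; last by rewrite big_seq1 scale1r.
by move=> c; rewrite inE => /eqP ->.
Qed.

Lemma submod_sum R M (I : Type) (r : seq I) (P : pred I) (F : I -> V) :
  is_submod R M -> (forall i, P i -> M (F i)) -> M (\sum_(i <- r | P i) F i).
Proof. by move=> [M0 MD _] MF; apply: (big_ind M). Qed.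

End Spans.

Section PrimeAbove.
Variable R : comNzRingType.

Definition proper_ideal_set (I : set R) : Prop :=
  [/\ I 0, forall x y, I x -> I y -> I (x + y),
      forall a x, I x -> I (a * x) & ~ I 1].

(** Turns a local-global argument into the exhibition of one multiplier outside each prime. *)
Lemma prime_ideal_above (I : set R) :
  proper_ideal_set I -> exists p : prime_idealr R, forall x, I x -> x \in p.
Proof.
move=> Ip; pose P := [set J | J = set0 \/ (proper_ideal_set J /\ I `<=` J)].
have [F FP Ftot|J [JP Jmax]] := @Zorn_bigcup R P.
  have [[J FJ [x Jx]]|no] := pselect (exists2 J, F J & J !=set0); last first.
    left; rewrite -subset0 => x [J FJ Jx]; apply: no.
    by exists J => //; exists x.
  have ideal_in H y : F H -> H y -> proper_ideal_set H /\ I `<=` H.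
    by move=> /FP[->|//].
  right; have [[J0 _ _ _] IJ] := ideal_in _ _ FJ Jx.
  split; last by move=> y /IJ; exists J.
  split.
  - by exists J.
  - move=> y z [H FH Hy] [G FG Gz].
    have [HG|GH] := Ftot _ _ FH FG.
      by exists G => //; have [[_ GD _ _] _] := ideal_in _ _ FG Gz; apply/GD/Gz/HG.
    by exists H => //; have [[_ HD _ _] _] := ideal_in _ _ FH Hy; apply/HD/GH.
  - move=> a y [H FH Hy]; exists H => //.
    by have [[_ _ HM _] _] := ideal_in _ _ FH Hy; apply: HM.
  - by move=> [H FH H1]; have [[_ _ _ /(_ H1)]] := ideal_in _ _ FH H1.
case: JP => [J0|[[J0 JD JM J1] IJ]].
  case: (Jmax I); last by right; split.
  rewrite J0; split; first exact: sub0set.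
  by case: Ip => I0 _ _ _ /(_ _ I0).
(* [H] below is J + aR; by maximality of [J] it cannot be proper. *)
have maxJ a : ~ J a -> exists b, J (1 - a * b).
  move=> Ja; pose H := [set x | exists b, J (x - a * b)].
  have JH : J `<=` H by move=> x Jx; exists 0; rewrite mulr0 subr0.
  have Ha : H a by exists 1; rewrite mulr1 subrr.
  have HI : proper_ideal_set H -> False.
    move=> Hp; apply: (Jmax H); last by right; split=> // x /IJ/JH.
    by split=> // /(_ _ Ha).
  apply: contrapT => no1; apply: HI; split=> //; first exact: JH.
    move=> x y [b xb] [c yc]; exists (b + c).
    by rewrite mulrDr opprD addrACA; apply: JD.
  by move=> c x [b xb]; exists (c * b); rewrite mulrCA -mulrBr; apply: JM.
pose p : {pred R} := fun x => `[< J x >].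
have pid : idealr_closed p.
  split; rewrite ?unfold_in; first exact/asboolP.
    exact/asboolP.
  move=> a x y; rewrite !unfold_in => /asboolP Jx /asboolP Jy.
  by apply/asboolP/JD => //; apply: JM.
have ppr : prime_idealr_closed p.
  move=> x y; rewrite !unfold_in => /asboolP Jxy.
  have [Jx|/maxJ[b Jb]] := pselect (J x); first by apply/orP; left; apply/asboolP.
  apply/orP; right; apply/asboolP.
  rewrite (_ : y = y * (1 - x * b) + b * (x * y)); last by ring.
  by apply: JD; apply: JM.
pose pI := isIdealr.Build R p pid; pose pP := isPrimeIdealrClosed.Build R p ppr.
pose q : prime_idealr R := HB.pack p pI pP.
by exists q => x /IJ Jx; apply/asboolP.
Qed.

End PrimeAbove.

Section QuotientDichotomy.
Variables (D : idomainType) (p : prime_idealr D).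

Lemma prime_neq0 s : s \notin p -> s != 0.
Proof. by apply: contraNneq => ->; rewrite rpred0. Qed.

Lemma notin_primeM s t : s \notin p -> t \notin p -> s * t \notin p.
Proof. by rewrite prime_idealrM negb_or => -> ->. Qed.

Lemma notin_prime_prod (I : Type) (r : seq I) (P : pred I) (F : I -> D) :
  (forall i, P i -> F i \notin p) -> \prod_(i <- r | P i) F i \notin p.
Proof.
move=> pF; apply: (big_ind (fun x => x \notin p)) => //.
  by rewrite idealr1.
exact: notin_primeM.
Qed.

Lemma compl_mult : mult_subset (compl p).
Proof.
split; rewrite /compl /=; [by rewrite idealr1|exact: notin_primeM|].
by rewrite rpred0.
Qed.

(** An infinite quotient is expressed by arbitrarily long incongruent sequences: they extend
    greedily, and a Vandermonde determinant needs only finitely many nodes. *)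
Lemma quotient_dichotomy :
  (exists l : seq D, forall x, exists2 a, a \in l & x - a \in p) \/
  (forall n, exists u : nat -> D,
     forall i j, (i < j < n)%N -> u j - u i \notin p).
Proof.
have [|noL] := pselect (exists l : seq D, forall x, exists2 a, a \in l & x - a \in p).
  by left.
right; elim=> [|n [u uP]]; first by exists (fun _ => 0) => i j; rewrite ltn0 andbF.
have [x xP] : exists x, forall a, a \in mkseq u n -> x - a \notin p.
  apply: contrapT => no; apply: noL; exists (mkseq u n) => x.
  apply: contrapT => no2; apply: no; exists x => a al.
  by apply/negP => xa; apply: no2; exists a.
exists (fun i => if i == n then x else u i) => i j /andP[ij].
rewrite ltnS leq_eqVlt => /predU1P[jn|jn].
  by rewrite jn eqxx ltn_eqF -?jn // xP //; apply/mapP; exists i; rewrite // mem_iota -jn.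
by rewrite !ltn_eqF ?(ltn_trans ij jn) // uP // ij.
Qed.

(** A finite domain is a field: by pigeonhole two powers of [a] are congruent, and the smaller one
    cancels because [p] is prime. *)
Lemma inv_mod_finite (l : seq D) :
  (forall x, exists2 a, a \in l & x - a \in p) ->
  forall a, a \notin p -> exists b, 1 - a * b \in p.
Proof.
move=> lP a ap.
have /choice[f fP] : forall x, exists i : 'I_(size l), x - nth 0 l i \in p.
  by move=> x; have [b /(nthP 0)[i il <-]] := lP x; exists (Ordinal il).
have /injectivePn[i [j ij fij]] :
    ~~ injectiveb (fun i : 'I_(size l).+1 => f (a ^+ i)).
  by apply/negP => /injectiveP/leq_card; rewrite !card_ord ltnn.
have {fij} aij : a ^+ i - a ^+ j \in p.
  have := rpredB (fP (a ^+ i)) (fP (a ^+ j)).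
  by rewrite fij opprB addrA subrK.
wlog {ij} ij : i j aij / (i < j)%N.
  move=> H; have [/H|/H|/val_inj e] := ltngtP i j; first exact.
    by apply; rewrite -opprB rpredN.
  by rewrite e eqxx in ij.
have ai k : a ^+ k \notin p.
  by elim: k => [|k IH]; rewrite ?idealr1 // exprS notin_primeM.
exists (a ^+ (j - i).-1); rewrite -exprS prednK ?subn_gt0 //.
move: aij; rewrite -[X in _ - a ^+ X](subnKC (ltnW ij)) exprD -[X in X - _]mulr1.
by rewrite -mulrBr prime_idealrM (negPf (ai _)).
Qed.

End QuotientDichotomy.

(** * The t-operation *)

Section DomPred.
Variable D : idomainType.
Local Notation K := {fraction D}.

Definition dom_pred : {pred K} := fun x => `[< dom D x >].

Lemma domP x : reflect (exists a : D, x = a%:F) (x \in dom_pred).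
Proof.
by apply: (iffP (asboolP _)) => [[a _ <-]|[a ->]]; exists a.
Qed.

Lemma domE x : dom D x <-> x \in dom_pred.
Proof. by split=> /asboolP. Qed.

Lemma tofrac_dom (a : D) : a%:F \in dom_pred.
Proof. by apply/domP; exists a. Qed.

Lemma dom_subring_closed : subring_closed dom_pred.
Proof.
split; first by apply/domP; exists 1; rewrite tofrac1.
  by move=> _ _ /domP[a ->] /domP[b ->]; rewrite -tofracB tofrac_dom.
by move=> _ _ /domP[a ->] /domP[b ->]; rewrite -tofracM tofrac_dom.
Qed.

HB.instance Definition _ := GRing.isSubringClosed.Build K dom_pred
  dom_subring_closed.

Lemma frac_dom (x : K) : exists a s : D, s != 0 /\ x = a%:F / s%:F.
Proof.
rewrite [x]frac_repr; exists (\n_(repr x)), (\d_(repr x)); split => //.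
exact: denom_ratioP.
Qed.

Lemma span_dom_closed (V : lmodType K) (X : set V) :
  is_submod (dom D) (span (dom D) X).
Proof. by apply: span_is_submod => c d; rewrite !domE; apply: rpredM. Qed.

Lemma span_submodule (X : set K) : submodule (@Defs.span K K^o (dom D) X).
Proof.
have [S0 SD SZ] := @span_dom_closed K^o X; split=> // a x.
by apply: SZ; rewrite domE tofrac_dom.
Qed.

Lemma submodule_is_submod (I : set K) : submodule I -> @is_submod K K^o (dom D) I.
Proof. by move=> [I0 ID IM]; split=> // _ v [a _ <-]; apply: IM. Qed.

Lemma common_denominator (s : seq K) :
  exists2 d : D, d != 0 & forall x, x \in s -> d%:F * x \in dom_pred.
Proof.
elim: s => [|y s [d d0 dP]]; first by exists 1; rewrite ?oner_neq0.
have [a [t [t0 ->]]] := frac_dom y.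
exists (d * t) => [|x]; first by rewrite mulf_neq0.
rewrite tofracM inE => /predU1P[->|/dP dx].
  by rewrite mulrA mulrAC mulfK ?tofrac_eq0 // -tofracM tofrac_dom.
by rewrite mulrAC rpredM // tofrac_dom.
Qed.

(* x belongs to J_v *)
Definition v_mem (J : seq K) (x : K) : Prop :=
  forall y, (forall a, a \in J -> y * a \in dom_pred) -> y * x \in dom_pred.

Definition has_nonzero (T : nmodType) (J : seq T) : Prop :=
  exists2 a, a \in J & a != 0.

Lemma span_dom_mul (X : set K) y z :
  (forall a, X a -> y * a \in dom_pred) -> @Defs.span K K^o (dom D) X z ->
  y * z \in dom_pred.
Proof.
move=> yX; pose M : set K^o := [set z | y * z \in dom_pred].
apply: (@span_min K K^o (dom D) X M) => //; rewrite /M; split=> /= [|u v|c v].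
- by rewrite mulr0 rpred0.
- by rewrite mulrDr; apply: rpredD.
- by rewrite domE /GRing.scale /= mulrCA; apply: rpredM.
Qed.

Lemma span_dom_gen (X : set K) : X `<=` @Defs.span K K^o (dom D) X.
Proof. by apply: (@span_gen K K^o); rewrite domE rpred1. Qed.

Lemma vclosure_span (J : seq K) x :
  vclosure (@Defs.span K K^o (dom D) [set` J]) x <-> v_mem J x.
Proof.
rewrite /vclosure /ideal_inv /=; split=> H y yJ.
  by rewrite mulrC -domE; apply: H => z; rewrite domE; apply: span_dom_mul.
rewrite mulrC domE; apply: H => a aJ; rewrite -domE; apply: yJ.
exact: span_dom_gen.
Qed.

(** Replaces finitely generated fractional ideals by lists of generators; being fractional is
    automatic, through a common denominator. *)
Lemma tclosureP (I : set K) x : submodule I -> tclosure I x <->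
  exists J, [/\ has_nonzero J, forall a, a \in J -> I a & v_mem J x].
Proof.
move=> subI; split=> [[J0 [[y Jy y0] [s sE] _ sI vx]]|[J [[a aJ a0] JI vx]]].
  subst; exists s; split; last exact/vclosure_span.
    apply: contrapT => no; suff /(_ y Jy)/eqP : 
        @Defs.span K K^o (dom D) [set` s] `<=` [set (0 : K^o)].
      by rewrite (negPf y0).
    apply: span_min => [|a /= sa].
      by split=> //= [u v -> ->|c v _ ->]; rewrite ?addr0 ?scaler0.
    by apply: contrapT => /eqP a0; apply: no; exists a.
  by move=> a sa; apply/sI/span_dom_gen.
exists (@Defs.span K K^o (dom D) [set` J]); split=> //.
- by exists a => //; apply: span_dom_gen.
- by exists J.
- split; first exact: span_submodule.
  have [d d0 dJ] := common_denominator J; exists d => // z.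
  by rewrite domE; apply: span_dom_mul.
- by apply: (@span_min K K^o) => //; apply: submodule_is_submod.
- exact/vclosure_span.
Qed.

Lemma v_mem_cat (J J' : seq K) x : v_mem J x -> {subset J <= J'} -> v_mem J' x.
Proof. by move=> Jx JJ' y yJ'; apply: Jx => a /JJ'/yJ'. Qed.

Lemma v_mem_mem (J : seq K) x : x \in J -> v_mem J x.
Proof. by move=> xJ y; apply. Qed.

Lemma v_memD (J : seq K) x y : v_mem J x -> v_mem J y -> v_mem J (x + y).
Proof. by move=> Jx Jy z zJ; rewrite mulrDr rpredD ?Jx ?Jy. Qed.

Lemma v_memM (J : seq K) c x : c \in dom_pred -> v_mem J x -> v_mem J (c * x).
Proof. by move=> cD Jx z zJ; rewrite mulrCA rpredM ?Jx. Qed.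

Lemma v_mem_trans (J J' : seq K) x :
  v_mem J x -> (forall a, a \in J -> v_mem J' a) -> v_mem J' x.
Proof. by move=> Jx JJ' y yJ'; apply: Jx => a /JJ'; apply. Qed.

End DomPred.

Arguments dom_pred : clear implicits.

Section LocSubring.
Variables (D : idomainType) (L : fieldType) (h : {rmorphism {fraction D} -> L}).
Variables (B : subringClosed L) (S : set D).
Hypotheses (hB : forall a, h a%:F \in B) (mS : mult_subset S).

(** This is S^-1 B inside [L], with [h] carrying [D] to [L]; it serves both for S^-1 D and for the
    localization of an extension at a prime of [D]. *)
Definition loc_pred : {pred L} :=
  fun x => `[< exists2 s, S s & h s%:F * x \in B >].

Lemma locP x : reflect (exists2 s, S s & h s%:F * x \in B) (x \in loc_pred).
Proof. exact: asboolP. Qed.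

Lemma loc_subring_closed : subring_closed loc_pred.
Proof.
case: mS => S1 SM S0; split.
- by apply/locP; exists 1 => //; rewrite mulr1.
- move=> x y /locP[s Ss sx] /locP[t St ty]; apply/locP.
  exists (s * t); first exact: SM.
  rewrite tofracM rmorphM mulrBr; apply: rpredB.
    by rewrite mulrAC rpredM.
  by rewrite -mulrA rpredM.
- move=> x y /locP[s Ss sx] /locP[t St ty]; apply/locP.
  exists (s * t); first exact: SM.
  by rewrite tofracM rmorphM mulrACA rpredM.
Qed.

Definition loc_subring : subringClosed L :=
  HB.pack loc_pred (GRing.isSubringClosed.Build L loc_pred loc_subring_closed).

Lemma loc_sub x : x \in B -> x \in loc_subring.
Proof.
by case: mS => S1 _ _ Bx; apply/locP; exists 1; rewrite ?tofrac1 ?rmorph1 ?mul1r.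
Qed.

Lemma loc_inv s : S s -> (h s%:F)^-1 \in loc_subring.
Proof.
move=> Ss; apply/locP; exists s => //; rewrite mulfV ?rpred1 // fmorph_eq0.
by rewrite tofrac_eq0; case: mS => _ _ S0; apply/eqP => s0; apply: S0; rewrite -s0.
Qed.

End LocSubring.

(** * t-ideals, existence and primality of t-maximal ideals *)

Section TIdeals.
Variables (D : idomainType).
Local Notation K := {fraction D}.

Lemma dom_idealP (p : {pred D}) x : dom_ideal p x <-> exists2 a, a \in p & x = a%:F.
Proof. by split=> [[a pa <-]|[a pa ->]]; exists a. Qed.

Lemma dom_ideal_tofrac (p : {pred D}) a : dom_ideal p a%:F <-> a \in p.
Proof.
split; last by exists a.
by move=> /dom_idealP[b pb /eqP]; rewrite tofrac_eq => /eqP ->.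
Qed.

Lemma dom_ideal_submodule (p : idealr D) : submodule (dom_ideal p).
Proof.
split=> [|x y|a x]; rewrite !dom_idealP.
- by exists 0; rewrite ?rpred0 ?tofrac0.
- by move=> [a pa ->] [b pb ->]; exists (a + b); rewrite ?rpredD ?tofracD.
- by move=> [b pb ->]; exists (a * b); rewrite ?idealMr ?tofracM.
Qed.

Lemma dom_ideal_sub (p : {pred D}) : dom_ideal p `<=` dom D.
Proof. by move=> _ [a _ <-]; rewrite domE tofrac_dom. Qed.

Lemma tclosure_dom (I : set K) : I `<=` dom D -> submodule I -> tclosure I `<=` dom D.
Proof.
move=> ID subI x /(tclosureP _ subI)[J [_ JI vx]]; rewrite domE -[x]mul1r.
by apply: vx => a /JI/ID; rewrite domE mul1r.
Qed.

Lemma sub_tclosure (I : set K) : submodule I -> nonzero I -> I `<=` tclosure I.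
Proof.
move=> subI [y Iy y0] x Ix; apply/tclosureP => //; exists [:: x; y]; split.
- by exists y => //; rewrite !inE eqxx orbT.
- by move=> a; rewrite !inE => /orP[]/eqP ->.
- by apply: v_mem_mem; rewrite mem_head.
Qed.

Lemma integral_frac_ideal (I : set K) : submodule I -> I `<=` dom D -> frac_ideal I.
Proof.
move=> subI ID; split=> //; exists 1; rewrite ?oner_neq0 // => x /ID.
by rewrite tofrac1 mul1r.
Qed.

Lemma tclosure_submodule (I : set K) : submodule I -> nonzero I -> submodule (tclosure I).
Proof.
move=> subI nI; split.
- by apply: sub_tclosure => //; case: subI.
- move=> x y /(tclosureP _ subI)[J [[a aJ a0] JI vx]] /(tclosureP _ subI)[J' [_ JI' vy]].
  apply/(tclosureP _ subI); exists (J ++ J'); split.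
  + by exists a; rewrite // mem_cat aJ.
  + by move=> b; rewrite mem_cat => /orP[/JI|/JI'].
  + by apply: v_memD; [apply: v_mem_cat vx _|apply: v_mem_cat vy _] => b;
      rewrite mem_cat => ->; rewrite ?orbT.
- move=> c x /(tclosureP _ subI)[J [nJ JI vx]].
  by apply/(tclosureP _ subI); exists J; split=> //; apply: v_memM; rewrite ?tofrac_dom.
Qed.

(** The finite witnesses of the elements of [J] are concatenated into one; hence the t-closure is
    idempotent. *)
Lemma tclosure_fin (I : set K) (J : seq K) : submodule I -> has_nonzero J ->
  (forall a, a \in J -> tclosure I a) ->
  exists J', [/\ has_nonzero J', forall a, a \in J' -> I a
               & forall a, a \in J -> v_mem J' a].
Proof.
move=> subI [a0 a0J _] JI.
have /choice[F FP] : forall a, exists J', a \in J ->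
    [/\ has_nonzero J', forall b, b \in J' -> I b & v_mem J' a].
  move=> a; have [/JI/(tclosureP _ subI)[J' J'P]|aJ] := boolP (a \in J).
    by exists J'.
  by exists [::].
exists (flatten (map F J)); split.
- have [[b bF b0] _ _] := FP _ a0J; exists b => //.
  by apply/flatten_mapP; exists a0.
- by move=> b /flatten_mapP[a /FP[_ FI _] /FI].
- move=> a aJ; have [_ _ va] := FP _ aJ; apply: v_mem_cat va _ => b bF.
  by apply/flatten_mapP; exists a.
Qed.

Lemma tclosure_idem (I : set K) : submodule I -> nonzero I ->
  tclosure (tclosure I) = tclosure I.
Proof.
move=> subI nI; have subT := tclosure_submodule subI nI.
apply/seteqP; split=> x; last first.
  apply: sub_tclosure => //; case: nI => y Iy y0; exists y => //.
  by apply: sub_tclosure => //; exists y.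
move=> /(tclosureP _ subT)[J [nJ /(tclosure_fin subI nJ)[J' [nJ' J'I vJ]] vx]].
by apply/tclosureP => //; exists J'; split=> //; apply: v_mem_trans vx vJ.
Qed.

Lemma tclosure_t_ideal (I : set K) : submodule I -> nonzero I -> I `<=` dom D ->
  t_ideal (tclosure I).
Proof.
move=> subI nI ID; have [y Iy y0] := nI; split; last by rewrite tclosure_idem.
  by exists y => //; apply: sub_tclosure.
by apply: integral_frac_ideal; [exact: tclosure_submodule|exact: tclosure_dom].
Qed.

Lemma ideal_eq_dom (I : set K) : submodule I -> I `<=` dom D -> I 1 -> I = dom D.
Proof.
move=> [_ _ IM] ID I1; apply/seteqP; split=> // _ [a _ <-].
by rewrite -[a%:F]mulr1; apply: IM.
Qed.

Lemma proper_t_idealP (I : set K) : submodule I -> nonzero I -> I `<=` dom D ->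
  proper_t_ideal I <->
  ~ I 1 /\ forall J x, has_nonzero J -> (forall a, a \in J -> I a) -> v_mem J x -> I x.
Proof.
move=> subI nI ID; split=> [[[_ _ IE] _ ID']|[I1 It]].
  split=> [I1|J x nJ JI vx]; first exact/ID'/ideal_eq_dom.
  by rewrite IE; apply/tclosureP => //; exists J.
split=> //; last by move=> IE; apply: I1; rewrite IE domE rpred1.
split=> //; first exact: integral_frac_ideal.
apply/seteqP; split; first exact: sub_tclosure.
by move=> x /(tclosureP _ subI)[J [nJ JI vx]]; apply: It vx.
Qed.

(* Zorn's lemma applies because the t-closure is finitary. *)
Lemma t_maximal_above (I : set K) : proper_t_ideal I ->
  exists2 M, t_maximal M & I `<=` M.
Proof.
move=> pI; pose P := [set J | J = set0 \/ (proper_t_ideal J /\ I `<=` J)].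
have props H : proper_t_ideal H -> [/\ submodule H, nonzero H & H `<=` dom D].
  by move=> [[nH [sH _] _] HD _].
have [sI nI ID] := props _ pI.
have [F FP Ftot|M [MP Mmax]] := @Zorn_bigcup K P.
  have [[J FJ [x Jx]]|no] := pselect (exists2 J, F J & J !=set0); last first.
    left; rewrite -subset0 => x [J FJ Jx]; apply: no.
    by exists J => //; exists x.
  have ideal_in H y : F H -> H y -> proper_t_ideal H /\ I `<=` H.
    by move=> /FP[->|//].
  right; have [pJ IJ] := ideal_in _ _ FJ Jx; have [sJ nJ JD] := props _ pJ.
  have IU : I `<=` \bigcup_(X in F) X by move=> y /IJ; exists J.
  split=> //; apply/proper_t_idealP.
  - split.
    + by exists J => //; case: sJ.
    + move=> y z [H FH Hy] [G FG Gz].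
      have [pH _] := ideal_in _ _ FH Hy; have [[_ HA _] _ _] := props _ pH.
      have [pG _] := ideal_in _ _ FG Gz; have [[_ GA _] _ _] := props _ pG.
      have [HG|GH] := Ftot _ _ FH FG; first by exists G => //; apply/GA/Gz/HG.
      by exists H => //; apply/HA/GH.
    + move=> a y [H FH Hy]; exists H => //.
      have [pH _] := ideal_in _ _ FH Hy; have [[_ _ HA] _ _] := props _ pH.
      exact: HA.
  - by case: nI => y Iy y0; exists y => //; apply: IU.
  - move=> y [H FH Hy]; have [pH _] := ideal_in _ _ FH Hy.
    by have [_ _ HD] := props _ pH; apply: HD.
  split.
    move=> [H FH H1]; have [pH _] := ideal_in _ _ FH H1.
    have [sH nH HD] := props _ pH.
    by have /(proper_t_idealP sH nH HD)[] := pH.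
  move=> T y nT TU vy.
  have [H FH TH] : exists2 H, F H & (I `<=` H) /\ forall a, a \in T -> H a.
    elim: T {nT vy} TU => [|b T IH] TU; first by exists J.
    have [a aT|H FH [IH' TH]] := IH; first by apply: TU; rewrite inE aT orbT.
    have [G FG Gb] := TU b (mem_head _ _).
    have [HG|GH] := Ftot _ _ FH FG.
      exists G => //; split=> [z /IH'/HG//|a].
      by rewrite inE => /predU1P[->//|/TH/HG].
    exists H => //; split=> // a.
    by rewrite inE => /predU1P[->//|/TH//]; apply: GH.
  have [y0 Iy0 _] := nI; have [pH _] := ideal_in _ _ FH (TH.1 _ Iy0).
  have [sH nH HD] := props _ pH; exists H => //.
  by have /(proper_t_idealP sH nH HD)[_ Ht] := pH; apply: Ht vy => //; case: TH.
case: MP => [M0|[pM IM]].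
  case: (Mmax I); last by right; split.
  rewrite M0; split; first exact: sub0set.
  by case: nI => y Iy _ /(_ _ Iy).
exists M => //; split=> // J pJ MJ; apply: contrapT => JM.
apply: (Mmax J); last by right; split=> // x /IM/MJ.
by split=> // JM'; apply: JM; apply/seteqP.
Qed.

(** If ab is in [M] and [a] is not, then M + aD has t-closure D, so 1 is in J_v for some finite [J]
    in M + aD; multiplying by [b] carries [J] into [M] and puts [b] in M_t = M. *)
Lemma t_maximal_prime (M : set K) : t_maximal M ->
  exists p : prime_idealr D, M = dom_ideal p.
Proof.
move=> [pM Mmax]; have [[nM [sM _] _] MD _] := pM.
have /(proper_t_idealP sM nM MD)[M1 Mt] := pM.
have [M0 MA MM] := sM.
pose p : {pred D} := fun a => `[< M a%:F >].
have pE a : (a \in p) = `[< M a%:F >] by [].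
have pid : idealr_closed p.
  split; rewrite ?pE; first by apply/asboolP; rewrite tofrac0.
    by apply/asboolP; rewrite tofrac1.
  move=> a x y; rewrite !pE => /asboolP Mx /asboolP My.
  by apply/asboolP; rewrite tofracD tofracM; apply: MA => //; apply: MM.
have ppr : prime_idealr_closed p.
  move=> a b; rewrite !pE => /asboolP Mab; apply/orP.
  have [Ma|Ma] := pselect (M a%:F); first by left; apply/asboolP.
  right; apply/asboolP.
  pose N := [set x | exists2 c : D, M (x - c%:F * a%:F) & x \in dom_pred D].
  have MN : M `<=` N.
    by move=> x Mx; exists 0; rewrite ?tofrac0 ?mul0r ?subr0 // -domE; apply: MD.
  have Na : N a%:F by exists 1; rewrite ?tofrac1 ?mul1r ?subrr ?tofrac_dom.
  have sN : submodule N.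
    split; first exact: MN.
      move=> x y [c cx xD] [d dy yD]; exists (c + d); last exact: rpredD.
      by rewrite tofracD mulrDl opprD addrACA; apply: MA.
    move=> e x [c cx xD]; exists (e * c); last by rewrite rpredM ?tofrac_dom.
    by rewrite tofracM -mulrA -mulrBr; apply: MM.
  have ND : N `<=` dom D by move=> x [c _]; rewrite domE.
  have nN : nonzero N by case: nM => y My y0; exists y => //; apply: MN.
  have : tclosure N = dom D.
    apply: contrapT => pN; apply: Ma.
    have <- : tclosure N = M; last exact: sub_tclosure.
    apply: Mmax; last by move=> x /MN; apply: sub_tclosure.
    by split=> //; [exact: tclosure_t_ideal|exact: tclosure_dom].
  move=> NE; have : tclosure N 1 by rewrite NE domE rpred1.
  move=> /(tclosureP _ sN)[J [nJ JN v1]].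
  (* For [b] zero the multiples of [J] by [b] would have no nonzero member. *)
  have [b0|b0] := eqVneq b 0; first by rewrite b0 tofrac0.
  rewrite -[b%:F]mulr1; apply: (Mt [seq b%:F * x | x <- J]).
  - case: nJ => x xJ x0; exists (b%:F * x); first by apply/mapP; exists x.
    by rewrite mulf_neq0 ?tofrac_eq0.
  - move=> _ /mapP[x /JN[c cx _] ->].
    rewrite -[x](subrK (c%:F * a%:F)) mulrDr; apply: MA; first exact: MM.
    by rewrite mulrCA -tofracM [b * a]mulrC; apply: MM.
  - move=> y yJ; rewrite mulrA; apply: v1 => x xJ; rewrite -mulrA.
    by apply: yJ; apply/mapP; exists x.
pose pI := isIdealr.Build D p pid; pose pP := isPrimeIdealrClosed.Build D p ppr.
pose q : prime_idealr D := HB.pack p pI pP.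
exists q; apply/seteqP; split=> x; last by move=> [a /asboolP Ma <-].
by move=> Mx; have [a _ ax] := MD _ Mx; exists a => //; apply/asboolP; rewrite ax.
Qed.

End TIdeals.

(** * Residue fields and the trichotomy for primes *)

Section ResidueSystems.
Variables (D : idomainType) (p : prime_idealr D).
Local Notation K := {fraction D}.

Definition complete_residues (l : seq D) : Prop :=
  forall x, exists2 a, a \in l & x - a \in p.

Lemma tofrac_local_proof (a : D) : a%:F \in local_pred p.
Proof. by apply/dom_atP; exists a, 1; rewrite idealr1 tofrac1 divr1. Qed.

Definition tofrac_local (a : D) : local_ring p := LocalRing (tofrac_local_proof a).

Lemma residue_class_eqP (x y : local_ring p) :
  residue_class x = residue_class y <->
  exists c s : D, [/\ c \in p, s \notin p & val x - val y = c%:F / s%:F].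
Proof.
rewrite (rwP eqP) residue_class_eq mem_max_pred rmorphB /=.
rewrite -max_setP; split=> [/asboolP|] H; [exact: H|exact/asboolP].
Qed.

Lemma residue_class_tofrac_eq (a b : D) :
  residue_class (tofrac_local a) = residue_class (tofrac_local b) <->
  a - b \in p.
Proof.
rewrite residue_class_eqP /=; split=> [[c [s [cp sp e]]]|ab]; last first.
  by exists (a - b), 1; rewrite idealr1 tofrac1 divr1 tofracB.
have s0 := compl_prime_neq0 sp.
have : (a - b) * s = c.
  by apply/eqP; rewrite -tofrac_eq tofracM tofracB e divfK.
move=> e'; have : (a - b) * s \in p by rewrite e'.
by rewrite prime_idealrM (negPf sp) orbF.
Qed.

(** When D/p is finite, D already maps onto the residue field: modulo [p] a fraction b/t equals b
    t', where t' inverts [t]. *)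
Lemma local_fraction_residue (l : seq D) b t : complete_residues l -> t \notin p ->
  exists a c, [/\ a \in l, c \in p & b%:F / t%:F - a%:F = c%:F / t%:F :> K].
Proof.
move=> lP tp; have [t' tt'] := inv_mod_finite lP tp.
have [a al ba] := lP (b * t'); exists a, (b - a * t); split=> //.
  rewrite (_ : b - a * t = b * (1 - t * t') + t * (b * t' - a)); last by ring.
  by rewrite rpredD // idealMr.
by rewrite tofracB tofracM mulrBl mulfK // (compl_prime_neq0 tp).
Qed.

(** D/p embeds in the residue field, so incongruent elements of [D] would outnumber a finite residue
    field; conversely a finite D/p maps onto it. *)
Lemma finite_residueP : finite_residue p <-> exists l, complete_residues l.
Proof.
split=> [|[l lP]].
  move=> /finite_seqP[s sE]; have [//|inf] := quotient_dichotomy p.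
  have [u uP] := inf (size s).+1.
  pose f (i : nat) := residue_class (tofrac_local (u i)).
  have us : uniq (mkseq f (size s).+1).
    rewrite map_inj_in_uniq ?iota_uniq // => i j; rewrite !mem_iota !add0n /=.
    wlog ij : i j / (i < j)%N.
      move=> H il jl e; have [/H|/H H'|//] := ltngtP i j; first exact.
      by apply/esym/H'.
    move=> _ js /esym/residue_class_tofrac_eq; apply: contraTeq => _.
    by apply: uP; rewrite ij.
  have ss : {subset mkseq f (size s).+1 <= s}.
    by move=> y _; have : [set: residue_field p] y by []; rewrite sE.
  by have := uniq_leq_size us ss; rewrite size_mkseq ltnn.
apply: (@sub_finite_set _ _ [set` [seq residue_class (tofrac_local a) | a <- l]]);
  last exact: finite_seq.
move=> y _ /=; have /dom_atP[b [t [tp yE]]] := valP (repr y).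
have [a [c [al cp e]]] := local_fraction_residue b lP tp.
apply/mapP; exists a => //; rewrite -[LHS]residue_classK.
by apply/residue_class_eqP; exists c, t; rewrite yE.
Qed.

(** The normalization [a 0 = 0] makes leading zero digits harmless in base-q expansions, and singles
    out the factor [x] in the product of the differences x - a_i. *)
Record residue_system (q : nat) (a : nat -> D) : Prop := ResidueSystem {
  rs_gt1 : (1 < q)%N;
  rs_0 : a 0 = 0;
  rs_inj : forall i j, (i < q)%N -> (j < q)%N -> a i - a j \in p -> i = j;
  rs_cover : forall x, exists2 i, (i < q)%N & x - a i \in p }.

Lemma residue_system_exists : finite_residue p -> exists q a, residue_system q a.
Proof.
move=> /finite_residueP[l lP].
have [l' [l'P l'inj]] : exists l',
    (forall x, x \in l -> exists2 a, a \in l' & x - a \in p) /\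
    forall i j, (i < j < size l')%N -> l'`_j - l'`_i \notin p.
  elim: l {lP} => [|b l [l' [l'P l'inj]]].
    by exists [::]; split=> // i j; rewrite ltn0 andbF.
  have [[a al' ba]|no] := pselect (exists2 a, a \in l' & b - a \in p).
    by exists l'; split=> // x; rewrite inE => /predU1P[->|/l'P]; first by exists a.
  exists (b :: l'); split.
    move=> x; rewrite inE => /predU1P[->|/l'P[a al' xa]].
      by exists b; rewrite ?mem_head // subrr rpred0.
    by exists a; rewrite // inE al' orbT.
  move=> [|i] [|j] //=; rewrite ltnS; last exact: l'inj.
  move=> jl'; apply/negP => jb; apply: no; exists l'`_j; first exact: mem_nth.
  by rewrite -opprB rpredN.
have cov x : exists2 i, (i < size l')%N & x - l'`_i \in p.
  have [b /l'P[a /(nthP 0)[i il <-] ba] xb] := lP x; exists i => //.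
  by rewrite -[x](subrK b) -addrA rpredD.
have inj i j : (i < size l')%N -> (j < size l')%N -> l'`_i - l'`_j \in p -> i = j.
  wlog ij : i j / (i < j)%N.
    move=> H il jl; have [/H|/H|//] := ltngtP i j; first exact.
    by rewrite -opprB rpredN => H' /H' ->.
  move=> _ jl; rewrite -opprB rpredN; apply: contraTeq => _.
  by apply: l'inj; rewrite ij.
have l'gt0 : (0 < size l')%N.
  by have [i il _] := cov 0; apply: leq_trans il.
(* Translation by the first residue makes the entry of index 0 vanish and changes no difference. *)
exists (size l'), (fun i => l'`_i - l'`_0); split.
- have [i il i0] := cov 0; have [j jl j1] := cov 1.
  have : i != j.
    apply/eqP => e; have := rpredB j1 i0.
    by rewrite e opprB addrA subrK subr0 idealr1.
  by case: (l') il jl => [|x [|y l1]] //=; case: (i) => //; case: (j).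
- by rewrite subrr.
- by move=> i j il jl; rewrite opprB addrA subrK; apply: inj.
- by move=> x; have [i il xi] := cov (x + l'`_0); exists i; rewrite // opprB addrA.
Qed.

(** Generation of pD_p by [pi], with denominators cleared so that it speaks of elements of [D]. *)
Record uniformizer (pi : D) : Prop := Uniformizer {
  uf_mem : pi \in p;
  uf_neq0 : pi != 0;
  uf_gen : forall c, c \in p -> exists s b, s \notin p /\ s * c = b * pi }.

Lemma span_singleton (R : subringClosed K) (x v : K) :
  @Defs.span K K^o [set` R] [set x] v -> exists2 y, y \in R & v = y * x.
Proof.
pose M : set K^o := [set v | exists2 y, y \in R & v = y * x].
apply: (@span_min K K^o [set` R] [set x] M).
  rewrite /M; split=> /= [|u w [y yR ->] [z zR ->]|c w cR [y yR ->]].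
  - by exists 0; rewrite ?rpred0 ?mul0r.
  - by exists (y + z); rewrite ?rpredD ?mulrDl.
  - by exists (c * y); rewrite ?rpredM // /GRing.scale /= mulrA.
by move=> _ ->; exists 1; rewrite ?rpred1 ?mul1r.
Qed.

Lemma dom_atE : dom_at p = [set` local_pred p].
Proof. by apply/seteqP; split=> x /asboolP. Qed.

(** The denominator of a generator of pD_p is a unit of D_p, so its numerator also generates; a
    nonzero element of [p] keeps that numerator from being 0. *)
Lemma uniformizer_exists : (exists2 c, c \in p & c != 0) ->
  (exists a, max_set p = @Defs.span _ {fraction D}^o (dom_at p) [set a]) ->
  exists pi, uniformizer pi.
Proof.
move=> [c0 c0p c00] [x xE].
have : max_set p x.
  by rewrite xE; apply: span_gen => //; rewrite dom_atE /= rpred1.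
move=> /max_setP[a [s [ap sp xas]]].
have gen c : c \in p -> exists s b, s \notin p /\ s * c = b * a.
  move=> cp; have : max_set p c%:F.
    by apply/max_setP; exists c, 1; rewrite idealr1 tofrac1 divr1.
  rewrite xE dom_atE => /span_singleton[y /dom_atP[b [t [tp ->]]]].
  rewrite xas mulf_div => e; exists (t * s), b; split; first exact: notin_primeM.
  apply/eqP; rewrite -tofrac_eq !tofracM e mulrC divfK //.
  by rewrite mulf_neq0 ?(compl_prime_neq0 sp) ?(compl_prime_neq0 tp).
exists a; split=> //; apply: contraTneq c0p => a0.
apply/negP => /gen[t [b [tp /eqP]]]; rewrite a0 mulr0 mulf_eq0 (negPf c00) orbF.
by rewrite (negPf (prime_neq0 tp)).
Qed.

End ResidueSystems.

Section PrimeCases.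
Variables (D : idomainType) (D_inf : infinite_set [set: D]).
Local Notation K := {fraction D}.

Definition infinite_quotient (p : prime_idealr D) : Prop :=
  forall n, exists u : nat -> D, forall i j, (i < j < n)%N -> u j - u i \notin p.

(** This says that p_t contains 1. *)
Definition t_dense (p : prime_idealr D) : Prop :=
  exists J : seq D, [/\ has_nonzero J, forall a, a \in J -> a \in p
                      & v_mem [seq a%:F | a <- J] 1].

(** When D/p is finite, [p] is maximal. Either p_t = D, or no element outside [p] enters p_t, so
    that [p] is a t-ideal and hence t-maximal. *)
Lemma prime_cases (p : prime_idealr D) : [\/ infinite_quotient p, t_dense p
  | t_maximal (dom_ideal p) /\ finite_residue p].
Proof.
have [[l lP]|] := quotient_dichotomy p; last by constructor 1.
have [pd|npd] := pselect (t_dense p); first by constructor 2.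
constructor 3; split; last by apply/finite_residueP; exists l.
have sp := dom_ideal_submodule p; have pD := @dom_ideal_sub D p.
have np : nonzero (dom_ideal p).
  (* This is where [D] must be infinite: if [p] were zero, D would equal its finite quotient D/p. *)
  suff [c cp c0] : exists2 c, c \in p & c != 0.
    by exists c%:F; rewrite ?tofrac_eq0 ?dom_ideal_tofrac.
  apply: contrapT => no; apply: D_inf.
  apply: sub_finite_set (finite_seq l) => x _ /=; have [a al xa] := lP x.
  suff /eqP : x - a = 0 by rewrite subr_eq0 => /eqP ->.
  by apply: contrapT => /eqP xa0; apply: no; exists (x - a).
have dense J : has_nonzero J -> (forall a, a \in J -> dom_ideal p a) ->
    v_mem J 1 -> False.
  move=> [a0 a0J a00] JI v1; apply: npd.
  have /choice[f fP] : forall a : K, exists b : D, a \in J -> b \in p /\ b%:F = a.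
    move=> a; have [/JI[b]|] := boolP (a \in J); first by exists b.
    by exists 0.
  exists (map f J); split.
  - exists (f a0); first exact: map_f.
    by rewrite -tofrac_eq0; have [_ ->] := fP _ a0J.
  - by move=> _ /mapP[a /fP[? _] ->].
  - move=> y yJ; apply: v1 => a aJ; have [_ <-] := fP _ aJ.
    by apply: yJ; rewrite -map_comp; apply/mapP; exists a.
have one_split (a b : D) : 1 = (1 - a * b)%:F + b%:F * a%:F :> K.
  by rewrite tofracB tofracM tofrac1 [b%:F * _]mulrC subrK.
(* With 1 - ab in [p] added to [J], the v-closure contains 1 as soon as it contains [a], against the
   failure of [t_dense]. *)
have maxp x J : x \in dom_pred D -> ~ dom_ideal p x -> has_nonzero J ->
    (forall a, a \in J -> dom_ideal p a) -> v_mem J x -> False.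
  move=> /domP[a ->] /dom_ideal_tofrac/negP ap [b0 b0J b00] JI va.
  have [b ab] := inv_mod_finite lP ap.
  apply: (dense ((1 - a * b)%:F :: J)).
  - by exists b0; rewrite // inE b0J orbT.
  - by move=> c; rewrite inE => /predU1P[->|/JI//]; apply/dom_ideal_tofrac.
  - rewrite (one_split a b); apply: v_memD; first by apply: v_mem_mem; rewrite mem_head.
    apply: v_memM; first exact: tofrac_dom.
    by apply: v_mem_cat va _ => c cJ; rewrite inE cJ orbT.
split.
  apply/proper_t_idealP => //; split.
    by rewrite -tofrac1 dom_ideal_tofrac idealr1.
  move=> J x nJ JI vx; apply: contrapT => px; apply: (maxp x J) => //.
  by rewrite -[x]mul1r; apply: vx => a /JI/pD; rewrite mul1r domE.
move=> I [[nI [sI _] tI] ID IneD] pI; apply/seteqP; split=> // x Ix.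
apply: contrapT => px; apply: IneD; apply: ideal_eq_dom => //.
have [a aE] : exists a : D, x = a%:F by have [a _ <-] := ID _ Ix; exists a.
move: Ix px; rewrite {}aE dom_ideal_tofrac => Ia /negP ap.
have [b ab] := inv_mod_finite lP ap; have [_ IA IM] := sI.
rewrite (one_split a b); apply: IA; last exact: IM.
by apply: pI; apply/dom_ideal_tofrac.
Qed.

Lemma t_max_fin_data (p : prime_idealr D) : standing_hyp D ->
  t_maximal (dom_ideal p) -> finite_residue p ->
  [/\ exists pi, uniformizer p pi, exists q a, residue_system p q a
    & Int_commutes_loc (compl p)].
Proof.
move=> H tp fp; have [pr Ic] := H p tp fp; split=> //.
  apply: uniformizer_exists => //; have [[[[x px x0] _ _] _ _] _] := tp.
  have [a ap xa] := (dom_idealP p x).1 px.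
  by exists a => //; rewrite -tofrac_eq0 -xa.
exact: residue_system_exists.
Qed.

End PrimeCases.

(** * Vandermonde determinants and regular sequences *)

Section Vandermonde.
Variables (L : fieldType) (B : subringClosed L).

Lemma det_closed n (M : 'M[L]_n) : (forall i j, M i j \in B) -> \det M \in B.
Proof.
move=> MB; apply: rpred_sum => s _; rewrite rpredM ?rpredX ?rpredN ?rpred1 //.
by apply: rpred_prod.
Qed.

(** Cramer's rule: the coefficient row times the Vandermonde matrix is the row of values, and the
    adjugate has entries in [B]. *)
Lemma vandermonde_scale n (f : {poly L}) (u : nat -> L) : (size f <= n)%N ->
  (forall i, u i \in B) -> (forall i, f.[u i] \in B) ->
  (\prod_(i < n) \prod_(j < n | (i < j)%N) (u j - u i)) *: f \is a polyOver B.
Proof.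
move=> fn uB fuB; apply/polyOverP => k; rewrite coefZ.
have [kn|nk] := ltnP k n; last by rewrite nth_default ?mulr0 ?rpred0 ?(leq_trans fn).
pose V := Vandermonde n (\row_(j < n) u j).
have -> : \prod_(i < n) \prod_(j < n | (i < j)%N) (u j - u i) = \det V.
  rewrite det_Vandermonde; apply: eq_bigr => i _; apply: eq_bigr => j _.
  by rewrite !mxE.
have cV : (\row_(i < n) f`_i *m V) = \row_(j < n) f.[u j].
  apply/rowP => j; rewrite !mxE (horner_coef_wide _ fn).
  by apply: eq_bigr => i _; rewrite !mxE.
have := congr1 (fun M => (M *m \adj V) 0 (Ordinal kn)) cV.
rewrite -mulmxA mul_mx_adj mul_mx_scalar !mxE => ->; apply: rpred_sum => j _.
rewrite !mxE rpredM // /cofactor rpredM ?rpredX ?rpredN ?rpred1 //.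
by apply: det_closed => i i'; rewrite !mxE rpredX.
Qed.

End Vandermonde.

Lemma vandermonde_powers (D : idomainType) (p : prime_idealr D) (a : D) n : a \in p ->
  exists M t, t \notin p /\
    \prod_(i < n) \prod_(j < n | (i < j)%N) (a ^+ j - a ^+ i) = a ^+ M * t.
Proof.
move=> ap; exists (\sum_(i < n) \sum_(j < n | (i < j)%N) (i : nat))%N.
exists (\prod_(i < n) \prod_(j < n | (i < j)%N) (a ^+ (j - i) - 1)); split.
  apply: notin_prime_prod => i _; apply: notin_prime_prod => j ij; apply/negP => H.
  have aij : a ^+ (j - i) \in p.
    by rewrite -(@prednK (j - i)) ?subn_gt0 // exprS mulrC idealMr.
  by have := rpredB aij H; rewrite opprB addrC subrK idealr1.
rewrite -prodrXr -big_split; apply: eq_bigr => i _ /=.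
rewrite -prodrXr -big_split; apply: eq_bigr => j ij /=.
by rewrite mulrBr mulr1 -exprD subnKC // ltnW.
Qed.

Section Extend.
Variables (D : idomainType) (L : fieldType) (h : {rmorphism {fraction D} -> L}).
Variable B : subringClosed L.

(* t-linkedness only needs to be tested on finite sets J with J_v = D. *)
Record t_linked_over : Prop := TLinkedOver {
  tl_sub : forall a, h a%:F \in B;
  tl_dense : forall J : seq D, has_nonzero J -> v_mem [seq a%:F | a <- J] 1 ->
    forall x, (forall a, a \in J -> x * h a%:F \in B) -> x \in B }.

Hypothesis tB : t_linked_over.

(** Density of [J] passes to powers of its elements, by induction on the sum of the exponents:
    passing from [x] to its product with [a] lowers the exponent of [a], and a zero exponent already
    puts [x] in [B]. *)
Lemma tl_dense_powers (J : seq D) : has_nonzero J -> v_mem [seq a%:F | a <- J] 1 ->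
  forall (e : D -> nat) x, (forall a, a \in J -> x * h a%:F ^+ e a \in B) -> x \in B.
Proof.
move=> nJ v1 e; have [m] := ubnP (\sum_(a <- J) e a).
elim: m e => // m IH e em x xJ.
have [[a aJ ea]|no] := pselect (exists2 a, a \in J & e a = 0).
  by have := xJ a aJ; rewrite ea mulr1.
apply: (tl_dense tB nJ v1) => a aJ.
pose e' := [eta e with a |-> (e a).-1].
have ea : (0 < e a)%N by rewrite lt0n; apply/eqP => ea; apply: no; exists a.
apply: (IH e') => [|b bJ].
  rewrite -ltnS; apply: leq_trans em; rewrite ltnS (big_rem a) //=.
  rewrite [X in (_ < X)%N](big_rem a) //= eqxx.
  rewrite -addSn prednK // leq_add2l; apply: leq_sum => b _ /=.
  by case: eqP => // ->; apply: leq_pred.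
rewrite /e' /=; case: eqP => [->|_]; first by rewrite -mulrA -exprS prednK // xJ.
by rewrite mulrAC rpredM ?xJ ?(tl_sub tB).
Qed.

Lemma dense_polyOver (p : prime_idealr D) (f : {poly L}) :
  infinite_quotient p \/ t_dense p -> (forall a, f.[h a%:F] \in B) ->
  exists2 s, s \notin p & h s%:F *: f \is a polyOver B.
Proof.
move=> pinf fD; pose n := size f.
have V (u : nat -> D) :
    h (\prod_(i < n) \prod_(j < n | (i < j)%N) (u j - u i))%:F *: f \is a polyOver B.
  have := @vandermonde_scale _ B n f (fun i => h (u i)%:F) (leqnn _).
  have -> : \prod_(i < n) \prod_(j < n | (i < j)%N) (h (u j)%:F - h (u i)%:F) =
      h (\prod_(i < n) \prod_(j < n | (i < j)%N) (u j - u i))%:F.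
    rewrite !rmorph_prod; apply: eq_bigr => i _; rewrite !rmorph_prod.
    by apply: eq_bigr => j _; rewrite !rmorphB.
  by apply => // i; apply: (tl_sub tB).
case: pinf => [/(_ n)[u uP]|[J [nJ Jp v1]]].
  exists (\prod_(i < n) \prod_(j < n | (i < j)%N) (u j - u i)); last exact: V.
  apply: notin_prime_prod => i _; apply: notin_prime_prod => j ij.
  by apply: uP; rewrite ij /=.
(* Each [a] in [J] gives an exponent M and a cofactor t outside [p] with a^M t f over [B]. The
   product of all cofactors works for every [a] simultaneously, and density removes the powers
   a^M. *)
have /choice[F FP] : forall a, exists Mt : nat * D, a \in J -> Mt.2 \notin p /\
    h (a ^+ Mt.1 * Mt.2)%:F *: f \is a polyOver B.
  move=> a; have [/Jp/(vandermonde_powers n)[M [t [tp e]]]|aJ] := boolP (a \in J).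
    by exists (M, t) => _; split=> //; rewrite /= -e; apply: V.
  by exists (0, 0).
exists (\prod_(a <- J) (F a).2).
  rewrite big_seq; apply: notin_prime_prod => a /FP[]. exact.
apply/polyOverP => k; rewrite coefZ.
apply: (tl_dense_powers nJ v1 (e := fun a => (F a).1)) => a aJ.
have [_ /polyOverP/(_ k)] := FP a aJ; rewrite coefZ (big_rem a) //= => H.
rewrite !(tofracM, rmorphM, tofracXn, rmorphXn) /= in H *.
rewrite (_ : _ * _ = h (\prod_(b <- rem a J) (F b).2)%:F *
   (h a%:F ^+ (F a).1 * h ((F a).2)%:F * f`_k)); last by ring.
by rewrite rpredM // (tl_sub tB).
Qed.

End Extend.

(** * Regular sequences from digit expansions, and Newton polynomials *)

Section RegularSequence.
Variables (D : idomainType) (p : prime_idealr D) (pi : D) (q : nat) (a : nat -> D).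
Hypotheses (pi_uf : uniformizer p pi) (aq : residue_system p q a).

(** The first argument is fuel, bounding the number of digits read; fuel beyond [n] only reads zero
    digits, which contribute nothing since [a 0 = 0]. *)
Fixpoint digit_sum (m n : nat) : D :=
  if m is m'.+1 then a (n %% q) + pi * digit_sum m' (n %/ q) else 0.

Let q1 : (1 < q)%N := rs_gt1 aq.
Let q0 : (0 < q)%N := ltnW q1.

Lemma digit_sum_stable m n : (n <= m)%N -> digit_sum m n = digit_sum n n.
Proof.
have [k] := ubnP n; elim: k n m => // k IH n [|m] nk; first by rewrite leqn0 => /eqP ->.
case: n nk => [|n] nk nm.
  have H j : digit_sum j 0 = 0.
    by elim: j => //= j IHj; rewrite mod0n div0n (rs_0 aq) IHj mulr0 addr0.
  by rewrite !H.
have nq : (n.+1 %/ q <= n)%N by rewrite -ltnS ltn_Pdiv.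
rewrite /= IH ?(leq_trans nq) // 1?[in RHS]IH //; first exact: leq_ltn_trans nq _.
exact: leq_ltn_trans nq _.
Qed.

(* The base-q digits of n, replaced by residues mod p, are the coefficients of powers of pi. *)
Definition reg_seq (n : nat) : D := digit_sum n n.
Local Notation u := reg_seq.

Lemma reg_seqE n : u n = a (n %% q) + pi * u (n %/ q).
Proof.
case: n => [|n]; first by rewrite /u /= mod0n div0n (rs_0 aq) add0r /= mulr0.
by rewrite /u /= digit_sum_stable // -ltnS ltn_Pdiv.
Qed.

(** The analogue of n!, which it would be for u_k = k; [reg_poly] is accordingly the analogue of the
    binomial polynomial. *)
Definition reg_weight (n : nat) : D := \prod_(0 <= k < n) (u n - u k).
Local Notation w := reg_weight.

(** Indices are grouped by their quotient by [q]: within a full block the elements of the sequence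
    share their higher digits and meet every residue class once. *)
Lemma prod_blocks (R : comNzRingType) (F : nat -> R) n :
  \prod_(0 <= k < n) F k =
  (\prod_(0 <= l < n %/ q) \prod_(0 <= s < q) F (l * q + s)%N) *
  \prod_(0 <= s < n %% q) F (n %/ q * q + s)%N.
Proof.
rewrite {1}(divn_eq n q) (big_cat_nat (n := n %/ q * q)) ?leq_addr //=.
congr (_ * _).
  rewrite big_nat_mul; apply: eq_bigr => l _.
  rewrite mulSn -[X in \prod_(X <= _ < _) _]add0n big_addn addnK.
  by apply: eq_bigr => s _; rewrite addnC.
rewrite -[X in \prod_(X <= _ < _) _]add0n big_addn addKn.
by apply: eq_bigr => s _; rewrite addnC.
Qed.

Lemma reg_seq_block l s : (s < q)%N -> u (l * q + s) = a s + pi * u l.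
Proof.
by move=> sq; rewrite reg_seqE modnMDl modn_small // divnMDl // divn_small // addn0.
Qed.

Lemma prod_block_factor (R : comNzRingType) (F : nat -> R) s : (s < q)%N ->
  \prod_(0 <= k < q) F k = F s * \prod_(0 <= k < q | k != s) F k.
Proof.
by move=> sq; rewrite (bigD1_seq s) ?mem_index_iota ?iota_uniq.
Qed.

(** Stands in for Legendre's formula for the valuation of n!. Each full block has exactly one
    element congruent to u_n, whose difference from u_n is [pi] times a difference at level
    [n %/ q]; the incomplete block stops before the residue of u_n. *)
Lemma reg_weight_rec n : exists2 e, e \notin p & w n = e * (pi ^+ (n %/ q) * w (n %/ q)).
Proof.
set m := (n %/ q)%N; set r := (n %% q)%N.
have rq : (r < q)%N by rewrite ltn_mod.
have un : u n = a r + pi * u m := reg_seqE n.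
have unit l s : (s < q)%N -> s != r -> a r + pi * u m - (a s + pi * u l) \notin p.
  move=> sq sr; apply/negP => H; case/eqP: sr; apply: (rs_inj aq) => //.
  have : pi * (u m - u l) - (a r + pi * u m - (a s + pi * u l)) \in p.
    by rewrite rpredB // mulrC idealMr // (uf_mem pi_uf).
  by congr (_ \in p); ring.
exists ((\prod_(0 <= l < m) \prod_(0 <= s < q | s != r) (u n - u (l * q + s)%N)) *
        \prod_(0 <= s < r) (u n - u (m * q + s)%N)).
  apply: notin_primeM.
    apply: notin_prime_prod => l _; rewrite big_nat_cond.
    apply: notin_prime_prod => s /= /andP[sq sr].
    by rewrite un reg_seq_block // unit.
  rewrite big_nat_cond; apply: notin_prime_prod => s; rewrite andbT /= => sr.
  have sq := ltn_trans sr rq.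
  by rewrite un reg_seq_block // unit // ltn_eqF.
rewrite /w prod_blocks -/m -/r.
under [X in X * _ = _]eq_bigr => l _.
  rewrite (prod_block_factor _ rq) reg_seq_block // un.
  rewrite (_ : _ - _ = pi * (u m - u l)); last by ring.
  over.
rewrite !big_split /= big_const_nat subn0 -/(w m) iter_mulr_1.
by rewrite -un; ring.
Qed.

Lemma reg_weight_neq0 n : w n != 0.
Proof.
have [k] := ubnP n; elim: k n => // k IH [|n] nk; first by rewrite /w big_geq ?oner_neq0.
have [e ep ->] := reg_weight_rec n.+1.
rewrite !mulf_neq0 ?(prime_neq0 ep) ?expf_neq0 ?(uf_neq0 pi_uf) // IH //.
by rewrite -ltnS; apply: leq_trans nk; rewrite ltnS ltn_Pdiv.
Qed.

Definition reg_poly (n : nat) : {poly {fraction D}} :=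
  ((w n)%:F)^-1 *: \prod_(0 <= k < n) ('X - (u k)%:F%:P).

Lemma size_reg_poly n : size (reg_poly n) = n.+1.
Proof.
rewrite size_scale ?invr_eq0 ?tofrac_eq0 ?reg_weight_neq0 //.
by rewrite size_prod_XsubC size_iota subn0.
Qed.

Section Values.
Variables (L : fieldType) (h : {rmorphism {fraction D} -> L}) (C : subringClosed L).
Hypotheses (hC : forall b, h b%:F \in C)
  (hCV : forall s, s \notin p -> (h s%:F)^-1 \in C).
(** Says that [pi] and the old residues still exhaust [C]; it will hold for D_p, and for A_Q when
    [Q] is unramified over [p] with trivial residue extension. *)
Hypothesis C_residue : forall x, x \in C ->
  exists s y, [/\ (s < q)%N, y \in C & x = h (a s)%:F + h pi%:F * y].

(** Writing x = a_s + pi y, every full block contributes one factor pi (y - u_l). The resulting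
    power of [pi] is exactly the one in [reg_weight_rec], and induction applies to [y] at level
    [n %/ q]. *)
Lemma reg_prod_div n x : x \in C ->
  (\prod_(0 <= k < n) (x - h (u k)%:F)) / h (w n)%:F \in C.
Proof.
have [k] := ubnP n; elim: k n x => // k IH [|n] x nk xC.
  by rewrite /w !big_geq // tofrac1 rmorph1 invr1 mulr1 rpred1.
have [e ep ->] := reg_weight_rec n.+1; rewrite prod_blocks.
set m := (n.+1 %/ q)%N; set r := (n.+1 %% q)%N.
have [s [y [sq yC xE]]] := C_residue xC.
under [X in X * _ / _]eq_bigr => l _.
  rewrite (prod_block_factor _ sq) reg_seq_block //.
  rewrite (_ : x - _ = h pi%:F * (y - h (u l)%:F)); last first.
    by rewrite xE !(tofracD, tofracM, rmorphD, rmorphM); ring.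
  over.
rewrite !big_split /= big_const_nat subn0 iter_mulr_1.
rewrite !(tofracM, tofracXn, rmorphM, rmorphXn) /=.
(* [Q1] gathers the remaining factors of the full blocks and [Q2] the incomplete block; both lie in
   [C]. *)
set P := \prod_(0 <= l < m) (y - _); set Q1 := \prod_(_ <= _ < _) _.
set Q2 := \prod_(_ <= _ < _) _.
have pi0 : h pi%:F != 0 by rewrite fmorph_eq0 tofrac_eq0 (uf_neq0 pi_uf).
have w0 : h (w m)%:F != 0 by rewrite fmorph_eq0 tofrac_eq0 reg_weight_neq0.
have e0 : h e%:F != 0 by rewrite fmorph_eq0 tofrac_eq0 (prime_neq0 ep).
rewrite (_ : _ / _ = (h e%:F)^-1 * Q1 * Q2 * (P / h (w m)%:F)); last first.
  by field; rewrite w0 e0 expf_neq0.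
have mk : (m < k)%N by rewrite -ltnS; apply: leq_trans nk; rewrite ltnS ltn_Pdiv.
apply: rpredM; last exact: IH.
apply: rpredM; first (apply: rpredM; first exact: hCV).
  by apply: rpred_prod => l _; apply: rpred_prod => i _; rewrite rpredB.
by apply: rpred_prod => l _; rewrite rpredB.
Qed.

Lemma reg_poly_int n x : x \in C -> (map_poly h (reg_poly n)).[x] \in C.
Proof.
move=> xC; have := reg_prod_div n xC; congr (_ \in C).
rewrite /reg_poly map_polyZ /= hornerZ fmorphV [RHS]mulrC; congr (_ * _).
rewrite rmorph_prod horner_prod; apply: eq_bigr => k _.
by rewrite rmorphB /= map_polyX map_polyC hornerXsubC.
Qed.

End Values.

Section Interpolation.
Variables (L : fieldType) (h : {rmorphism {fraction D} -> L}) (C : subringClosed L).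

Lemma reg_poly_root n j : (j < n)%N -> (map_poly h (reg_poly n)).[h (u j)%:F] = 0.
Proof.
move=> jn; rewrite horner_map hornerZ horner_prod.
rewrite (_ : \prod_(0 <= k < n) _ = 0) ?mulr0 ?rmorph0 //.
apply/eqP; rewrite prodf_seq_eq0; apply/hasP; exists j; first by rewrite mem_index_iota.
by rewrite hornerXsubC subrr eqxx.
Qed.

Lemma reg_poly_one n : (map_poly h (reg_poly n)).[h (u n)%:F] = 1.
Proof.
rewrite horner_map /= hornerZ horner_prod.
under eq_bigr => k _ do rewrite hornerXsubC -tofracB.
by rewrite -rmorph_prod mulVf ?rmorph1 // tofrac_eq0 reg_weight_neq0.
Qed.

Lemma reg_seq_inj : injective u.
Proof.
move=> i j; wlog ij : i j / (i < j)%N.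
  by move=> H e; have [/H/(_ e)|/H/(_ (esym e))|//] := ltngtP i j.
move=> e; have := reg_weight_neq0 j.
by rewrite /w (bigD1_seq i) ?iota_uniq ?mem_index_iota //= e subrr mul0r eqxx.
Qed.

(** The matrix of values of the Newton polynomials along the sequence is triangular with 1 on the
    diagonal, so the coefficients are found without any division and stay in [C]. *)
Lemma newton_interpolation (f : {poly L}) :
  (forall n j, (map_poly h (reg_poly n)).[h (u j)%:F] \in C) ->
  (forall j, f.[h (u j)%:F] \in C) ->
  exists c : nat -> L, (forall n, c n \in C) /\
    f = \sum_(n < size f) c n *: map_poly h (reg_poly n).
Proof.
move=> gC fC; set g := fun n => map_poly h (reg_poly n).
have sz n : size (g n) = n.+1 by rewrite size_map_poly size_reg_poly.
have step N : exists c : nat -> L, (forall n, c n \in C) /\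
    forall j, (j < N)%N -> (f - \sum_(n < N) c n *: g n).[h (u j)%:F] = 0.
  elim: N => [|N [c [cC cP]]]; first by exists (fun=> 0); split=> // n; rewrite rpred0.
  pose r := f - \sum_(n < N) c n *: g n.
  exists (fun n => if n == N then r.[h (u N)%:F] else c n); split.
    move=> n; case: eqP => // _; rewrite hornerD hornerN horner_sum rpredB //.
    by apply: rpred_sum => i _; rewrite hornerZ rpredM ?gC.
  move=> j; rewrite big_ord_recr /= eqxx opprD addrA hornerD hornerN hornerZ.
  under eq_bigr => i _ do rewrite ltn_eqF //.
  rewrite -/r ltnS leq_eqVlt => /predU1P[->|jN]; first by rewrite reg_poly_one mulr1 subrr.
  by rewrite reg_poly_root // mulr0 subr0 cP.
have [c [cC cP]] := step (size f); exists c; split=> //; apply/eqP.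
rewrite -subr_eq0; apply/negPn/negP => r0.
(* The remainder has size at most [size f] but vanishes at [size f] distinct points. *)
set r := f - _ in r0 cP.
have := max_poly_roots r0 (rs := mkseq (fun j => h (u j)%:F) (size f)).
rewrite size_mkseq => H.
have sr : (size r <= size f)%N.
  rewrite (leq_trans (size_polyD _ _)) // geq_max leqnn size_polyN.
  rewrite (leq_trans (size_sum _ _ _)) //; apply/bigmax_leqP => i _.
  by rewrite (leq_trans (size_scale_leq _ _)) // sz.
suff : (size f < size r)%N by rewrite ltnNge sr.
apply: H.
  by apply/allP => x /mapP[j]; rewrite mem_iota => /andP[_ jf] ->; apply/rootP/cP.
rewrite map_inj_uniq ?iota_uniq // => i j /(fmorph_inj h)/eqP.
by rewrite tofrac_eq => /eqP/reg_seq_inj.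
Qed.

End Interpolation.

End RegularSequence.

(** * Int(D), localization and t-linked extensions *)

Section LocalRing.
Variables (D : idomainType) (p : prime_idealr D).
Local Notation K := {fraction D}.

Lemma local_pred_inv s : s \notin p -> (s%:F)^-1 \in local_pred p.
Proof. by move=> sp; apply/dom_atP; exists 1, s; rewrite tofrac1 mul1r. Qed.

Lemma local_residue (pi : D) (q : nat) (a : nat -> D) x :
  uniformizer p pi -> residue_system p q a -> x \in local_pred p ->
  exists s y, [/\ (s < q)%N, y \in local_pred p & x = (a s)%:F + pi%:F * y].
Proof.
move=> up aq /dom_atP[b [t [tp ->]]].
have aP : complete_residues p (mkseq a q).
  move=> z; have [i iq zi] := rs_cover aq z; exists (a i) => //.
  by apply/mapP; exists i; rewrite // mem_iota.
have [_ [c [/mapP[s sq ->] cp e]]] := local_fraction_residue b aP tp.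
have [v [d [vp e']]] := uf_gen up cp.
exists s, (d%:F / (v * t)%:F); split; first by move: sq; rewrite mem_iota.
  by apply/dom_atP; exists d, (v * t); rewrite notin_primeM.
rewrite -[LHS](subrK (a s)%:F) e addrC; congr (_ + _); apply/eqP.
rewrite mulrA -tofracM eqr_div ?tofrac_eq0 ?mulf_neq0 ?(prime_neq0 tp) ?(prime_neq0 vp) //.
by rewrite -!tofracM tofrac_eq mulrA [c * v]mulrC e' [pi * d]mulrC.
Qed.

Lemma reg_poly_local (pi : D) (q : nat) (a : nat -> D) n x :
  uniformizer p pi -> residue_system p q a -> x \in local_pred p ->
  (reg_poly pi q a n).[x] \in local_pred p.
Proof.
move=> up aq xp; rewrite -[reg_poly _ _ _ _](map_poly_id (g := idfun)) //.
apply: (reg_poly_int (h := idfun) up aq) => //=.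
- by move=> b; apply: tofrac_local_proof.
- exact: local_pred_inv.
- by move=> y; apply: local_residue.
Qed.

End LocalRing.

Section IntLocalization.
Variables (D : idomainType).
Local Notation K := {fraction D}.

Lemma IntDE (f : {poly K}) : IntD D f <-> forall a : D, f.[a%:F] \in dom_pred D.
Proof.
split=> [fD a|fD _ [a _ <-]]; last by rewrite domE.
by rewrite -domE; apply: fD; exists a.
Qed.

Lemma IntD_Xn n : IntD D 'X^n.
Proof. by apply/IntDE => a; rewrite hornerXn rpredX ?tofrac_dom. Qed.

(* Cahen-Chabert: s^d f(X) - f(sX) has degree smaller than d = deg f *)
Lemma int_fraction (R : subringClosed K) (f : {poly K}) (a s : D) :
  (forall b : D, b%:F \in R) -> (s%:F)^-1 \in R -> s != 0 ->
  (forall b : D, f.[b%:F] \in R) -> f.[a%:F / s%:F] \in R.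
Proof.
move=> DR sR s0; have [m] := ubnP (size f); elim: m f => // m IH f fm fD.
have [f0|f0] := eqVneq f 0; first by rewrite f0 horner0 rpred0.
have [d fd] : exists d, size f = d.+1.
  by exists (size f).-1; rewrite prednK // size_poly_gt0.
pose g := \poly_(i < d) (f`_i * (s%:F ^+ d - s%:F ^+ i)).
have gE y : g.[y] = s%:F ^+ d * f.[y] - f.[s%:F * y].
  rewrite horner_poly !horner_coef fd mulr_sumr -sumrB big_ord_recr /=.
  rewrite (_ : s%:F ^+ d * _ - _ = 0) ?addr0; last by rewrite exprMn; ring.
  by apply: eq_bigr => i _; rewrite exprMn; ring.
have gR : g.[a%:F / s%:F] \in R.
  apply: IH => [|b]; first by rewrite -ltnS (leq_trans _ fm) // fd ltnS ltnS size_poly.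
  by rewrite gE -tofracM -tofracXn rpredB ?rpredM.
have sF0 : s%:F != 0 :> K by rewrite tofrac_eq0.
rewrite (_ : f.[_] = (s%:F)^-1 ^+ d * (g.[a%:F / s%:F] + f.[a%:F])).
  by rewrite rpredM ?rpredX ?rpredD.
by rewrite gE [s%:F * _]mulrC divfK // subrK mulrA -exprMn mulVf // expr1n mul1r.
Qed.

Section Mult.
Variables (S : set D) (mS : mult_subset S).

Lemma dom_pred_tofrac (a : D) : idfun a%:F \in dom_pred D.
Proof. exact: tofrac_dom. Qed.

Definition dom_loc_pred : subringClosed K :=
  loc_subring (h := idfun) dom_pred_tofrac mS.

Lemma dom_locP x : dom_loc S x <-> x \in dom_loc_pred.
Proof.
have S0 s : S s -> s%:F != 0 :> K.
  by case: mS => _ _ nS0 Ss; rewrite tofrac_eq0; apply/eqP => s0; apply: nS0; rewrite -s0.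
split=> [[s [_ [Ss [a _ <-] ->]]]|/locP[s Ss /= /domP[a e]]].
  apply/locP; exists s => //=.
  by rewrite /GRing.scale /= mulVKf ?S0 // tofrac_dom.
exists s, a%:F; split=> //; first by exists a.
by rewrite -e /GRing.scale /= mulKf ?S0.
Qed.

Lemma dom_locE : dom_loc S = [set` dom_loc_pred].
Proof. by apply/seteqP; split=> x /dom_locP. Qed.

Lemma dom_loc_frac x : x \in dom_loc_pred -> exists a s : D,
  [/\ S s, s != 0 & x = a%:F / s%:F].
Proof.
have S0 s : S s -> s != 0.
  by case: mS => _ _ nS0 Ss; apply/eqP => s0; apply: nS0; rewrite -s0.
move=> /locP[s Ss /domP[a /= e]]; exists a, s; split=> //; first exact: S0.
by rewrite -e mulrC mulKf // tofrac_eq0 S0.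
Qed.

Lemma localize_is_submod (V : lmodType K) (M : set V) :
  is_submod (dom D) M -> is_submod (dom_loc S) (localize S M).
Proof.
have S0 s : S s -> s%:F != 0 :> K.
  by case: mS => _ _ nS0 Ss; rewrite tofrac_eq0; apply/eqP => s0; apply: nS0; rewrite -s0.
case: mS => S1 SM _; move=> [M0 MD MZ].
have MZ' (a : D) v : M v -> M (a%:F *: v) by apply: MZ; exists a.
split.
- by exists 1, 0; rewrite scaler0.
- move=> _ _ [s [m [Ss Mm ->]]] [t [n [St Mn ->]]].
  exists (s * t), (t%:F *: m + s%:F *: n); split; first exact: SM.
    by apply: MD; apply: MZ'.
  rewrite tofracM invfM scalerDr !scalerA mulfVK ?S0 // mulrAC.
  by rewrite [_^-1 * s%:F]mulVf ?S0 // mul1r.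
- move=> c _ /dom_locP/dom_loc_frac[a [s [Ss _ ->]]] [t [m [St Mm ->]]].
  exists (s * t), (a%:F *: m); split; [exact: SM|exact: MZ'|].
  by rewrite !scalerA tofracM invfM -mulrA mulrC.
Qed.

Lemma sub_localize (V : lmodType K) (M : set V) : M `<=` localize S M.
Proof. by case: mS => S1 _ _ v Mv; exists 1, v; rewrite tofrac1 invr1 scale1r. Qed.

Lemma IntD_is_submod : is_submod (dom D) (IntD D).
Proof.
split=> [|f g|c f]; rewrite ?IntDE.
- by move=> a; rewrite horner0 rpred0.
- by move=> fD gD a; rewrite hornerD rpredD.
- by rewrite domE => cD fD a; rewrite hornerZ rpredM.
Qed.

(** The inclusion valid over every domain: integrality on [D] passes to fractions by
    [int_fraction]. *)
Lemma localize_IntD_sub : localize S (IntD D) `<=` Int (dom_loc S) (dom_loc S).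
Proof.
move=> _ [s [f [Ss /IntDE fD ->]]] x; rewrite !dom_locP => /dom_loc_frac[a [t [St t0 ->]]].
have DS b : b \in dom_pred D -> b \in dom_loc_pred by exact: loc_sub.
have Si u : S u -> (u%:F)^-1 \in dom_loc_pred by exact: loc_inv.
rewrite hornerZ rpredM ?Si //.
apply: int_fraction => //; first by move=> b; apply/DS/tofrac_dom.
  exact: Si.
by move=> b; apply: DS.
Qed.

End Mult.

Lemma dom_at_local (p : prime_idealr D) x : dom_at p x <-> x \in local_pred p.
Proof. by split=> /asboolP. Qed.

End IntLocalization.

Section Regular.
Variables (D : idomainType) (D_inf : infinite_set [set: D]) (D_hyp : standing_hyp D).
Local Notation K := {fraction D}.

Lemma t_linked_self : t_linked_over (idfun : {rmorphism K -> K}) (dom_pred D).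
Proof.
split=> [a|J _ v1 x xJ]; first exact: tofrac_dom.
by rewrite -[x]mulr1; apply: v1 => _ /mapP[a /xJ xa ->].
Qed.

Section Over.
Variables (L : fieldType) (h : {rmorphism K -> L}) (B : subringClosed L).
Hypothesis tB : t_linked_over h B.

Lemma polyOver_span (f : {poly L}) : f \is a polyOver B ->
  span [set` B] (map_poly h @` IntD D) f.
Proof.
move=> /polyOverP fB; rewrite -[f]coefK poly_def; apply: submod_sum => [|i _].
  by apply: span_is_submod => c d; apply: rpredM.
have [_ _ SZ] : is_submod [set` B] (span [set` B] (map_poly h @` IntD D)).
  by apply: span_is_submod => c d; apply: rpredM.
apply: SZ; first exact: fB; apply: span_gen; first exact: rpred1.
by exists 'X^i; [exact: IntD_Xn|rewrite map_polyXn].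
Qed.

(* It suffices to find, for each prime p, a multiplier outside p, since the
   multipliers form an ideal of D. *)
Lemma Int_over_span (f : {poly L}) : (forall a, f.[h a%:F] \in B) ->
  span [set` B] (map_poly h @` IntD D) f.
Proof.
move=> fB; set M := span _ _.
have [M0 MD MZ] : is_submod [set` B] M.
  by apply: span_is_submod => c d; apply: rpredM.
have MZ' (a : D) v : M v -> M (h a%:F *: v) by apply: MZ; exact: (tl_sub tB).
apply: contrapT => Mf.
have /prime_ideal_above[p pP] : proper_ideal_set [set a : D | M (h a%:F *: f)].
  split=> /= [|x y Mx My|a x Mx|]; rewrite ?rmorph0 ?scale0r //.
  - by rewrite !rmorphD scalerDl; apply: MD.
  - by rewrite !rmorphM -scalerA; apply: MZ'.
  - by rewrite !rmorph1 scale1r.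
suff [s sp Ms] : exists2 s, s \notin p & M (h s%:F *: f).
  by case/negP: sp; apply: pP.
have [inf|dense|[tp fp]] := prime_cases D_inf p.
- have [s sp sf] := dense_polyOver tB (or_introl inf) fB.
  by exists s => //; apply: polyOver_span.
- have [s sp sf] := dense_polyOver tB (or_intror dense) fB.
  by exists s => //; apply: polyOver_span.
have [[pi up] [q [a aq]] Ic] := t_max_fin_data D_hyp tp fp.
pose C := loc_subring (tl_sub tB) (compl_mult p).
have hC x : x \in local_pred p -> h x \in C.
  move=> /dom_atP[b [t [tp' ->]]]; rewrite fmorph_div rpredM //.
    by apply: loc_sub; apply: (tl_sub tB).
  exact: loc_inv.
have [|j|c [cC ->]] := @newton_interpolation _ _ _ _ _ up aq L h C f.
- move=> n j; rewrite horner_map; apply: hC; apply: reg_poly_local up aq _.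
  exact: tofrac_local_proof.
- by apply: loc_sub.
pose Q (v : {poly L}) := exists2 s, s \notin p & M (h s%:F *: v).
apply: (big_ind Q) => [|u v [s sp Mu] [t tp' Mv]|n _].
- by exists 1; rewrite ?idealr1 // scaler0.
- exists (s * t); first exact: notin_primeM.
  have -> : h (s * t)%:F *: (u + v) = h t%:F *: (h s%:F *: u) + h s%:F *: (h t%:F *: v).
    by rewrite tofracM rmorphM scalerDr !scalerA [h t%:F * _]mulrC.
  by apply: MD; apply: MZ'.
(* By Int(D_p) = Int(D)_p the Newton polynomial has a denominator [s] outside [p], and its
   coefficient [c n] has a denominator [t] outside [p]; clearing both puts the term into the
   span. *)
have : Int (dom_loc (compl p)) (dom_loc (compl p)) (reg_poly pi q a n).
  by move=> x /dom_at_local xp; apply/dom_at_local/(reg_poly_local _ up aq).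
rewrite Ic => -[s [m [sp mD ->]]].
have /locP[t tp' tc] := cC n.
exists (t * s); first exact: notin_primeM.
rewrite map_polyZ /= scalerA scalerA fmorphV tofracM rmorphM.
rewrite (_ : _ * _ = h t%:F * c n); last first.
  by field; rewrite fmorph_eq0 tofrac_eq0 (prime_neq0 sp).
by apply: MZ => //; apply: span_gen; [exact: rpred1|exists m].
Qed.

End Over.

(** One generator in each degree makes independence automatic; the induction on [m] kills the
    coefficients of a relation from the largest size downwards. *)
Lemma free_of_degrees (R : subringClosed K) (M : set {poly K})
    (g : nat -> {poly K}) :
  is_submod [set` R] M -> (forall n, size (g n) = n.+1) -> (forall n, M (g n)) ->
  (forall f, M f -> exists c : nat -> K, (forall n, c n \in R) /\
     f = \sum_(n < size f) c n *: g n) ->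
  free_module [set` R] M.
Proof.
move=> subM gs gM Mg; exists (range g); split.
- by move=> _ [n _ <-].
- apply/seteqP; split=> [|f /Mg[c [cR ->]]]; first by apply: span_min => // _ [n _ <-].
  have subS : is_submod [set` R] (span [set` R] (range g)).
    by apply: span_is_submod => x y; apply: rpredM.
  apply: (submod_sum _ subS) => n _; have [_ _ SZ] := subS.
  by apply: SZ; [exact: cR|apply: span_gen; [exact: rpred1|exists n]].
- move=> s c us sB sum0.
  have sz v : v \in s -> size v = (size v).-1.+1 /\ v = g (size v).-1.
    by move=> /sB[[n _ <-] _]; rewrite gs.
  suff H m v : v \in s -> (size v > \max_(w <- s) size w - m)%N -> c v = 0.
    move=> v vs; apply: (H (\max_(w <- s) size w)) => //.
    by have [-> _] := sz v vs; rewrite subnn.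
  elim: m v => [|m IH] v vs.
    have := @leq_bigmax_seq _ s xpredT (fun w : {poly K} => size w) v vs isT.
    by rewrite subn0 ltnNge => ->.
  move=> vm; have [/IH->//|_] := ltnP (\max_(w <- s) size w - m) (size v).
  (* In the leading degree of [v], smaller polynomials contribute 0 and larger ones have coefficient
     0 by induction. *)
  have := congr1 (fun f : {poly K} => f`_(size v).-1) sum0.
  rewrite coef0 coef_sum (bigD1_seq v) //= coefZ big1_seq ?addr0 => [|w /andP[wv ws]].
    move/eqP; rewrite mulf_eq0 -/(lead_coef v) lead_coef_eq0 -size_poly_eq0.
    by have [-> _] := sz v vs; rewrite orbF => /eqP.
  rewrite coefZ; have [wsz|wsz] := leqP (size w) (size v).-1.
    by rewrite nth_default ?mulr0.
  have [sv gv] := sz v vs; have [sw gw] := sz w ws.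
  have mv : (\max_(w <- s) size w - m <= size v)%N.
    by move: vm; rewrite subnS; case: (_ - _)%N.
  rewrite (IH w) ?mul0r //; apply: (leq_ltn_trans mv); rewrite ltn_neqAle.
  apply/andP; split; last by rewrite sv.
  by apply: contraNneq wv => e; rewrite gw gv e.
Qed.

(** Where Vandermonde determinants apply, Int(D)_p = D_p[X] has the powers of X as a basis;
    otherwise the Newton polynomials form one. *)
Lemma IntD_locally_free : locally_free (IntD D).
Proof.
move=> p; set M := localize _ _; rewrite dom_atE.
have subM : is_submod [set` local_pred p] M.
  by rewrite -dom_atE; apply: (localize_is_submod (compl_mult p) (@IntD_is_submod D)).
have poly_case : infinite_quotient p \/ t_dense p ->
    free_module [set` local_pred p] M.
  move=> cp; apply: (@free_of_degrees _ _ (fun n => 'X^n)) => //.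
  - by move=> n; rewrite size_polyXn.
  - by move=> n; apply: (sub_localize (compl_mult p)); apply: IntD_Xn.
  - move=> _ [t [f [tp /IntDE fD ->]]].
    have [s sp /polyOverP sf] := dense_polyOver t_linked_self cp fD.
    set v := _ *: f; exists (fun n => v`_n); split.
      move=> n; rewrite coefZ; have := sf n; rewrite coefZ => /domP[a /= e].
      rewrite (_ : f`_n = a%:F / s%:F).
        by rewrite rpredM ?local_pred_inv // rpredM ?local_pred_inv // tofrac_local_proof.
      by rewrite -e mulrC mulKf // tofrac_eq0 (prime_neq0 sp).
    by rewrite -[LHS]coefK poly_def.
have [inf|dense|[tp fp]] := prime_cases D_inf p.
- by apply: poly_case; left.
- by apply: poly_case; right.
have [[pi up] [q [a aq]] Ic] := t_max_fin_data D_hyp tp fp.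
have ME : M = Int (dom_loc (compl p)) (dom_loc (compl p)) by rewrite Ic.
apply: (@free_of_degrees _ _ (reg_poly pi q a)) => //.
- by move=> n; apply: (size_reg_poly up aq).
- move=> n; rewrite ME => x /dom_at_local xp.
  exact/dom_at_local/(reg_poly_local _ up aq).
- move=> f; rewrite ME => fI.
  have [||c [cC fE]] := @newton_interpolation _ _ _ _ _ up aq _ idfun (local_pred p) f.
  + move=> n j; rewrite map_poly_id //.
    exact: (reg_poly_local _ up aq (tofrac_local_proof _ _)).
  + by move=> j; apply/dom_at_local/fI/dom_at_local/tofrac_local_proof.
  exists c; split=> //; rewrite {1}fE; apply: eq_bigr => n _.
  by rewrite map_poly_id.
Qed.

(** S^-1 D is an instance of [t_linked_over]: for a finite [J] one [s] in [S] clears all products of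
    [x] with elements of [J], and then sx is in [D] because J_v = D. *)
Lemma Int_commutes_loc_all (S : set D) : mult_subset S -> Int_commutes_loc S.
Proof.
move=> mS; apply/seteqP; split; last exact: localize_IntD_sub.
move=> f fI; pose B := dom_loc_pred mS.
have tB : t_linked_over (idfun : {rmorphism K -> K}) B.
  split=> [a|J _ v1 x xJ]; first by apply: loc_sub; apply: tofrac_dom.
  have [s Ss sJ] : exists2 s, S s & forall a, a \in J -> s%:F * (x * a%:F) \in dom_pred D.
    have [S1 SM _] := mS; elim: J xJ {v1} => [|b J IH] xJ; first by exists 1.
    have [a aJ|s Ss sJ] := IH; first by apply: xJ; rewrite inE aJ orbT.
    have /locP[t St tb] := xJ b (mem_head _ _).
    exists (s * t) => [|a]; first exact: SM.
    rewrite tofracM inE => /predU1P[->|/sJ saJ].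
      by rewrite -mulrA rpredM // tofrac_dom.
    by rewrite mulrAC rpredM // tofrac_dom.
  apply/locP; exists s => //=; rewrite -[_ * x]mulr1; apply: v1 => _ /mapP[a aJ ->].
  by rewrite -mulrA sJ.
have fB (a : D) : f.[idfun a%:F] \in B.
  by apply/(dom_locP mS)/fI/(dom_locP mS); apply: loc_sub; apply: tofrac_dom.
apply: span_min (Int_over_span tB fB).
  by rewrite -dom_locE; apply: localize_is_submod => //; apply: IntD_is_submod.
by move=> _ [g gD <-]; rewrite map_poly_id //; apply: sub_localize.
Qed.

Section Extension.
Variables (A : idomainType) (phi : {rmorphism D -> A}) (phi_inj : injective phi).
Local Notation L := {fraction A}.
Local Notation iota := (frac_map phi_inj).

(** For I generated by [J] one has I_t = D, hence (IA)_t = A. If xJ is in [A] then so is xIA, and a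
    finite part of IA whose v-closure contains 1 forces [x] into [A]. *)
Lemma t_linked_overP : t_linked phi_inj -> t_linked_over iota (dom_pred A).
Proof.
move=> tl; split=> [a|J nJ v1 x xJ]; first by rewrite /= frac_map_tofrac tofrac_dom.
set J' := [seq a%:F | a <- J] in v1.
pose I := @Defs.span K K^o (dom D) [set` J'].
have sI : submodule I := span_submodule _.
have J'I a : a \in J' -> I a by move=> aJ; apply: span_dom_gen.
have ID : I `<=` dom D.
  move=> z Iz; rewrite domE -[z]mul1r; apply: span_dom_mul Iz => _ /mapP[a _ ->].
  by rewrite mul1r tofrac_dom.
have nJ' : has_nonzero J'.
  by have [a aJ a0] := nJ; exists a%:F; [exact: map_f|rewrite tofrac_eq0].
have nI : nonzero I by have [a /J'I Ia a0] := nJ'; exists a.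
have TI : tclosure I = dom D.
  apply: ideal_eq_dom; [exact: tclosure_submodule|exact: tclosure_dom|].
  by apply/tclosureP => //; exists J'.
have := tl I (conj sI ID) nI TI; set I' := @Defs.span _ _ _ _ => T1.
have /(tclosureP _ (span_submodule _))[J1 [_ J1I v1']] : tclosure I' 1.
  by rewrite T1 domE rpred1.
rewrite -[x]mulr1; apply: v1' => z /J1I; apply: span_dom_mul => _ [y Iy <-].
pose N : set K^o := [set y | x * iota y \in dom_pred A].
suff : I `<=` N by apply.
apply: span_min => [|_ /= /mapP[a aJ ->]]; last exact: xJ.
rewrite /N; split=> /= [|u v|c v].
- by rewrite rmorph0 mulr0 rpred0.
- by rewrite rmorphD mulrDr; apply: rpredD.
- move=> [a _ <-] xv; rewrite /GRing.scale /= rmorphM /= frac_map_tofrac mulrCA.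
  by apply: rpredM; [exact: tofrac_dom|exact: xv].
Qed.

Lemma Int_extE (f : {poly L}) :
  Int_ext phi_inj f <-> forall a : D, f.[iota a%:F] \in dom_pred A.
Proof.
split=> [fE a|fE _ [_ [a _ <-] <-]]; last by rewrite domE.
by rewrite -domE; apply: fE; exists a%:F => //; exists a.
Qed.

Lemma domA_E : dom A = [set` dom_pred A].
Proof. by apply/seteqP; split=> x; rewrite /= domE. Qed.

Lemma t_linked_regular : t_linked phi_inj -> polynomially_regular phi_inj.
Proof.
move=> /t_linked_overP tl; apply/seteqP; split=> f.
  by move=> /Int_extE fE; rewrite domA_E; apply: Int_over_span.
apply: span_min => [|_ [g /IntDE gD <-]].
  split=> [|u v /Int_extE uE /Int_extE vE|c v]; rewrite ?Int_extE.
  - by move=> a; rewrite horner0 rpred0.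
  - by move=> a; rewrite hornerD rpredD.
  - by rewrite domE => cA vE a; rewrite hornerZ rpredM.
apply/Int_extE => a; rewrite horner_map /=; have /domP[b ->] := gD a.
by rewrite frac_map_tofrac tofrac_dom.
Qed.

End Extension.

End Regular.

(** * Polynomially complete extensions *)

Lemma bijective_finite_separable (F E : fieldType) (f : {rmorphism F -> E}) :
  bijective f -> finite_separable f.
Proof.
move=> [g fK gK]; split; last first.
  move=> y; exists ('X - (g y)%:P); split; first exact: irredp_XsubC.
    by rewrite separable_poly.unlock derivXsubC coprimep1.
  by rewrite rmorphB /= map_polyX map_polyC root_XsubC /= gK.
by exists [:: 1] => y; exists (fun=> g y); rewrite big_seq1 mulr1 gK.
Qed.

Section PolynomiallyComplete.
Variables (D : idomainType) (D_inf : infinite_set [set: D]) (D_hyp : standing_hyp D).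
Variables (A : idomainType) (phi : {rmorphism D -> A}) (phi_inj : injective phi).
Local Notation K := {fraction D}.
Local Notation L := {fraction A}.
Local Notation iota := (frac_map phi_inj).

Lemma prime_idealr_preim (Q : prime_idealr A) :
  exists p : prime_idealr D, lies_over phi Q p.
Proof.
pose p : {pred D} := fun a => phi a \in Q.
have pE a : (a \in p) = (phi a \in Q) by [].
have pid : idealr_closed p.
  split; rewrite ?pE ?rmorph0 ?rpred0 ?rmorph1 ?idealr1 // => a x y.
  by rewrite !pE rmorphD rmorphM => xQ yQ; rewrite rpredD // idealMr.
have ppr : prime_idealr_closed p.
  by move=> x y; rewrite !pE rmorphM prime_idealrM.
pose pI := isIdealr.Build D p pid; pose pP := isPrimeIdealrClosed.Build D p ppr.
pose q : prime_idealr D := HB.pack p pI pP.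
by exists q => a.
Qed.

Section Over.
Variables (p : prime_idealr D) (Q : prime_idealr A) (Qp : lies_over phi Q p).

Lemma iota_local x : x \in local_pred p -> iota x \in local_pred Q.
Proof.
move=> /dom_atP[b [t [tp ->]]]; rewrite frac_mapE ?(prime_neq0 tp) //.
by apply/dom_atP; exists (phi b), (phi t); rewrite Qp.
Qed.

Lemma max_set_is_submod : @is_submod L L^o (dom_at Q) (max_set Q).
Proof.
apply: span_is_submod => c d; rewrite dom_atE; exact: rpredM.
Qed.

(** Surjectivity on residue fields approximates [x] by an element of D_p modulo the maximal ideal of
    A_Q; unramifiedness makes the error a multiple of [pi], and D_p has the required
    decomposition. *)
Lemma unramified_residue (pi : D) (q : nat) (a : nat -> D) x :
  uniformizer p pi -> residue_system p q a ->
  @Defs.span L L^o (dom_at Q) (iota @` dom_ideal p) = max_set Q ->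
  bijective (residue_map phi_inj Qp) -> x \in local_pred Q ->
  exists s y, [/\ (s < q)%N, y \in local_pred Q & x = iota (a s)%:F + iota pi%:F * y].
Proof.
move=> up aq sQ [f fK gK] xQ; pose X := LocalRing xQ.
pose z := repr (f (residue_class X)).
have : residue_class X = residue_class (local_map phi_inj Qp z).
  by rewrite -residue_mapE residue_classK gK.
move=> /residue_class_eqP[c [s [cQ sQ' /= e]]].
(* This is the ideal of A_Q generated by [pi]. *)
pose M : set L^o := [set v | exists2 y, y \in local_pred Q & v = iota pi%:F * y].
have spanM : @Defs.span L L^o (dom_at Q) (iota @` dom_ideal p) `<=` M.
  apply: span_min.
    rewrite dom_atE /M; split=> /= [|_ _ [y yQ ->] [w wQ ->]|d _ dQ [y yQ ->]].
    - by exists 0; rewrite ?rpred0 ?mulr0.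
    - by exists (y + w); rewrite ?rpredD ?mulrDr.
    - by exists (d * y); rewrite ?rpredM // /GRing.scale /= mulrCA.
  move=> _ [_ /dom_idealP[b bp ->] <-]; have [v [d [vp vb]]] := uf_gen up bp.
  exists ((phi d)%:F / (phi v)%:F).
    by apply/dom_atP; exists (phi d), (phi v); rewrite Qp.
  have v0 : (phi v)%:F != 0 :> L.
    by rewrite tofrac_eq0 -(rmorph0 phi) (inj_eq phi_inj) (prime_neq0 vp).
  rewrite !frac_map_tofrac; apply: (mulIf v0); rewrite -mulrA divfK // -!tofracM -!rmorphM.
  by rewrite mulrC vb mulrC.
have [y yQ yE] : M (x - iota (val z)).
  by apply: spanM; rewrite sQ; apply/max_setP; exists c, s; rewrite -e.
have [i [w [iq wp zE]]] := local_residue up aq (valP z).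
exists i, (iota w + y); split=> //; first by rewrite rpredD // iota_local.
rewrite mulrDr addrA -yE addrC -[LHS](subrK (iota (val z))); congr (_ + _).
by rewrite zE rmorphD rmorphM.
Qed.

End Over.

Hypothesis tl : t_linked phi_inj.

Lemma complete_of_unramified :
  (forall p : prime_idealr D, t_maximal (dom_ideal p) -> finite_residue p ->
     unramified_at phi_inj p /\ trivial_residue_at phi_inj p) ->
  polynomially_complete phi_inj.
Proof.
move=> H; apply/seteqP; split=> f; last first.
  by move=> /IntDE fA; apply/Int_extE => a; rewrite frac_map_tofrac.
(* By regularity it is enough that elements of Int(D) take [A] into [A]. *)
rewrite (t_linked_regular D_inf D_hyp tl).
apply: span_min => [|_ [g gD <-]]; first exact: IntD_is_submod.
apply/IntDE => x; set y := _.[_]; apply: contrapT => yA.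
(* The denominators of [y] form a proper ideal; the contradiction will be a denominator outside a
   prime [Q] containing it. *)
have /prime_ideal_above[Q QP] : proper_ideal_set [set c : A | c%:F * y \in dom_pred A].
  split=> /= [|c d cA dA|c d dA|]; rewrite ?tofrac0 ?mul0r ?rpred0 ?tofrac1 ?mul1r //.
  - by rewrite tofracD mulrDl rpredD.
  - by rewrite tofracM -mulrA rpredM // tofrac_dom.
have [p Qp] := prime_idealr_preim Q.
have gDE := (IntDE g).1 gD.
have dense : infinite_quotient p \/ t_dense p -> False.
  move=> cp; have [s sp sg] := dense_polyOver (t_linked_self D) cp gDE.
  have : phi s \in Q.
    apply: QP => /=; rewrite -(frac_map_tofrac phi_inj) -hornerZ -map_polyZ.
    have : map_poly iota (s%:F *: g) \is a polyOver (dom_pred A).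
      apply/polyOverP => n; rewrite coef_map; have /polyOverP/(_ n)/domP[b ->] := sg.
      by rewrite /= frac_map_tofrac tofrac_dom.
    by move=> /rpred_horner; apply; apply: tofrac_dom.
  by rewrite Qp (negPf sp).
have [inf|den|[tp fp]] := prime_cases D_inf p.
- by case: dense; left.
- by case: dense; right.
have [[pi up] [q [a aq]] Ic] := t_max_fin_data D_hyp tp fp.
have [/(_ Q Qp)[sQ _] /(_ Q Qp) bQ] := H p tp fp.
have yQ : y \in local_pred Q.
  have [||c [cC gE]] := @newton_interpolation _ _ _ _ _ up aq _ idfun (local_pred p) g.
  - move=> n j; rewrite map_poly_id //.
    exact: (reg_poly_local _ up aq (tofrac_local_proof _ _)).
  - by move=> j; have /domP[b -> ] := gDE (reg_seq pi q a j); apply: tofrac_local_proof.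
  rewrite /y gE rmorph_sum horner_sum; apply: rpred_sum => n _.
  rewrite (map_poly_id (g := idfun)) // /= map_polyZ hornerZ rpredM //.
    exact: (iota_local Qp).
  apply: (reg_poly_int up aq (h := iota) (C := local_pred Q)).
  - by move=> b; rewrite /= frac_map_tofrac tofrac_local_proof.
  - move=> s sp; rewrite /= frac_map_tofrac local_pred_inv //.
    by rewrite Qp.
  - by move=> z; apply: (unramified_residue up aq sQ bQ).
  - exact: tofrac_local_proof.
have /dom_atP[b [t [tQ yE]]] := yQ.
have t0 := prime_neq0 tQ; case/negP: tQ; apply: QP => /=.
by rewrite yE mulrC divfK ?tofrac_dom // tofrac_eq0.
Qed.

(** * Consequences of polynomial completeness at one prime *)

Section Converse.
Hypothesis complete : polynomially_complete phi_inj.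
Variables (p : prime_idealr D) (pi : D) (q : nat) (a : nat -> D).
Hypotheses (up : uniformizer p pi) (aq : residue_system p q a).
Hypothesis Ic : Int_commutes_loc (compl p).

(** The polynomial [G] generalizes (X^q - X)/q for a prime number q. It maps D_p to itself because
    one factor is divisible by [pi]; after multiplication by some [s] outside [p] it is in Int(D),
    and completeness makes it integer-valued on [A]. *)
Lemma complete_fermat : exists2 s, s \notin p & forall x : A, exists b,
  phi s * \prod_(0 <= i < q) (x - phi (a i)) = phi pi * b.
Proof.
pose G : {poly K} := (pi%:F)^-1 *: \prod_(0 <= i < q) ('X - (a i)%:F%:P).
have pi0 : pi%:F != 0 :> K by rewrite tofrac_eq0 (uf_neq0 up).
have : Int (dom_loc (compl p)) (dom_loc (compl p)) G.
  move=> x /dom_at_local xp; apply/dom_at_local.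
  have [s [y [sq yp xE]]] := local_residue up aq xp.
  rewrite hornerZ horner_prod; under eq_bigr => i _ do rewrite hornerXsubC.
  rewrite (prod_block_factor _ sq).
  have -> : x - (a s)%:F = pi%:F * y by rewrite xE addrC addKr.
  rewrite -[_ * y * _]mulrA mulKf // rpredM //; apply: rpred_prod => i _.
  by rewrite rpredB // tofrac_local_proof.
rewrite Ic => -[s [m [sp mD GE]]]; exists s => // x.
have s0 : s%:F != 0 :> K by rewrite tofrac_eq0 (prime_neq0 sp).
have mE : m = s%:F *: G by rewrite GE scalerA mulfV // scale1r.
have : Int_ext phi_inj (map_poly iota m).
  apply/Int_extE => b; rewrite horner_map /=; have /domP[c ->] := (IntDE m).1 mD b.
  by rewrite frac_map_tofrac tofrac_dom.
have pi0' : (phi pi)%:F != 0 :> L.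
  by rewrite tofrac_eq0 -(rmorph0 phi) (inj_eq phi_inj) (uf_neq0 up).
have prodE : (map_poly iota (\prod_(0 <= i < q) ('X - (a i)%:F%:P))).[x%:F] =
    (\prod_(0 <= i < q) (x - phi (a i)))%:F.
  rewrite !rmorph_prod horner_prod; apply: eq_bigr => i _.
  by rewrite rmorphB /= map_polyX map_polyC hornerXsubC /= frac_map_tofrac tofracB.
rewrite complete => /IntDE/(_ x)/domP[b e]; exists b; apply/eqP.
rewrite -tofrac_eq !tofracM -e mE /G scalerA map_polyZ hornerZ prodE /= fmorph_div.
by rewrite /= !frac_map_tofrac mulrCA mulrA divfK.
Qed.

Variables (Q : prime_idealr A) (Qp : lies_over phi Q p).

(** Since [phi pi] is in [Q] and [phi s] is not, the prime [Q] must contain a factor of the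
    product. *)
Lemma complete_residue (x : A) : exists2 i, (i < q)%N & x - phi (a i) \in Q.
Proof.
apply: contrapT => no; have [s sp /(_ x)[b e]] := complete_fermat.
have : phi s * \prod_(0 <= i < q) (x - phi (a i)) \in Q.
  by rewrite e mulrC idealMr // Qp (uf_mem up).
rewrite prime_idealrM Qp (negPf sp) /=; apply/negP.
rewrite big_nat_cond; apply: notin_prime_prod => i /andP[/= iq _].
by apply/negP => xi; apply: no; exists i.
Qed.

(** For [x] in [Q] the only factor lying in [Q] is the one of index 0, namely [x]; the others are
    units of A_Q. *)
Lemma complete_principal (x : A) : x \in Q -> exists t b, t \notin Q /\ t * x = phi pi * b.
Proof.
move=> xQ; have [s sp /(_ x)[b]] := complete_fermat.
have q0 : (0 < q)%N := ltnW (rs_gt1 aq).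
rewrite (prod_block_factor _ q0) (rs_0 aq) rmorph0 subr0 mulrCA mulrC => e.
exists (phi s * \prod_(0 <= i < q | i != 0) (x - phi (a i))), b; split=> //.
apply: notin_primeM; first by rewrite Qp.
rewrite big_nat_cond; apply: notin_prime_prod => i /andP[/= iq i0].
apply/negP => xi; case/eqP: i0; apply: (rs_inj aq) => //.
by rewrite (rs_0 aq) subr0 -Qp -[phi _](subKr x) rpredB.
Qed.

Lemma complete_max_set :
  @Defs.span L L^o (dom_at Q) (iota @` dom_ideal p) = max_set Q.
Proof.
apply/seteqP; split.
  apply: span_min; first exact: max_set_is_submod.
  move=> _ [_ /dom_idealP[b bp ->] <-]; apply/max_setP; exists (phi b), 1.
  by rewrite idealr1 Qp tofrac1 divr1 frac_map_tofrac.
move=> _ /max_setP[x [u [xQ uQ ->]]].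
have [t [b [tQ e]]] := complete_principal xQ.
have [_ _ SZ] : @is_submod L L^o (dom_at Q)
    (@Defs.span L L^o (dom_at Q) (iota @` dom_ideal p)).
  by apply: span_is_submod => c d; rewrite dom_atE; apply: rpredM.
rewrite (_ : _ / _ = (b%:F / (t * u)%:F) * iota pi%:F).
  apply: SZ.
    by rewrite dom_atE; apply/dom_atP; exists b, (t * u); rewrite notin_primeM.
  apply: (@span_gen L L^o); first by rewrite dom_atE /= rpred1.
  by exists pi%:F => //; apply/dom_ideal_tofrac/(uf_mem up).
rewrite frac_map_tofrac mulrAC -tofracM [b * _]mulrC -e; apply/eqP.
rewrite eqr_div ?tofrac_eq0 ?mulf_neq0 ?(prime_neq0 tQ) ?(prime_neq0 uQ) //.
by rewrite -!tofracM mulrCA mulrA.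
Qed.

Lemma complete_bijective : bijective (residue_map phi_inj Qp).
Proof.
have surj y : exists x, residue_map phi_inj Qp x = y.
  have /dom_atP[b [t [tQ yE]]] := valP (repr y).
  (* Numerator and denominator are replaced separately by elements coming from [D]. *)
  have [i iq ti] := complete_residue t; have [j jq bj] := complete_residue b.
  have aip : a i \notin p.
    apply/negP; rewrite -Qp => aiQ; case/negP: tQ.
    by rewrite -[t](subrK (phi (a i))) rpredD.
  have xp : (a j)%:F / (a i)%:F \in local_pred p by apply/dom_atP; exists (a j), (a i).
  exists (residue_class (LocalRing xp)); rewrite residue_mapE.
  rewrite -[RHS]residue_classK; apply/residue_class_eqP; rewrite yE /=.
  have ai0 : phi (a i) != 0 by rewrite (@prime_neq0 _ Q) ?Qp.
  exists (phi (a j) * t - b * phi (a i)), (phi (a i) * t); split.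
  - rewrite (_ : _ - _ = b * (t - phi (a i)) - t * (b - phi (a j))); last by ring.
    by rewrite rpredB // idealMr.
  - by rewrite notin_primeM // Qp.
  - rewrite frac_mapE ?(prime_neq0 aip) // -mulNr addf_div ?tofrac_eq0 ?(prime_neq0 tQ) //.
    by rewrite tofracB !tofracM mulNr.
have /choice[g gP] := surj; exists g => // x.
by apply: (fmorph_inj (residue_map phi_inj Qp)); rewrite /= gP.
Qed.

End Converse.

Lemma t_linked_complete : polynomially_complete phi_inj <->
  forall p : prime_idealr D, t_maximal (dom_ideal p) -> finite_residue p ->
    unramified_at phi_inj p /\ trivial_residue_at phi_inj p.
Proof.
split=> [complete p tp fp|]; last exact: complete_of_unramified.
have [[pi up] [q [a aq]] Ic] := t_max_fin_data D_hyp tp fp.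
split=> Q Qp; last exact: (complete_bijective complete up aq Ic).
split; first exact: (complete_max_set complete up aq Ic Qp).
exact/bijective_finite_separable/(complete_bijective complete up aq Ic).
Qed.

End PolynomiallyComplete.

(** * TV domains and H PVMDs *)

Section TMaximal.
Variable D : idomainType.
Local Notation K := {fraction D}.

Lemma t_maximal_props (M : set K) : t_maximal M ->
  [/\ submodule M, nonzero M, M `<=` dom D, ~ M 1 & forall J x, has_nonzero J ->
    (forall a, a \in J -> M a) -> v_mem J x -> M x].
Proof.
move=> [pM _]; have [[nM [sM _] _] MD _] := pM.
by have /(proper_t_idealP sM nM MD)[] := pM.
Qed.

Lemma tclosure_sub_maximal (M I : set K) : t_maximal M -> submodule I -> I `<=` M ->
  tclosure I `<=` M.
Proof.
move=> /t_maximal_props[_ _ _ _ Mt] sI IM x /(tclosureP _ sI)[J [nJ JI]].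
by apply: Mt => // a /JI/IM.
Qed.

(** The ideal of denominators of [x], a proper t-ideal when [x] is not in [D]. *)
Definition conductor (x : K) : set K := [set c | c \in dom_pred D /\ c * x \in dom_pred D].

Lemma conductor_submodule x : submodule (conductor x).
Proof.
split=> [|c d [cD cx] [dD dx]|a c [cD cx]]; rewrite /conductor /= ?mul0r ?rpred0 //.
  by split; rewrite ?mulrDl rpredD.
by split; rewrite -?mulrA; apply: rpredM; rewrite ?tofrac_dom.
Qed.

Lemma conductor_proper_t x : x \notin dom_pred D -> proper_t_ideal (conductor x).
Proof.
move=> xD; apply/proper_t_idealP.
- exact: conductor_submodule.
- have [a [s [s0 e]]] := frac_dom x; exists s%:F; last by rewrite tofrac_eq0.
  by split; rewrite ?tofrac_dom // e mulrC divfK ?tofrac_eq0 // tofrac_dom.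
- by move=> c [cD _]; rewrite domE.
split=> [[_]|J y nJ JC vy]; first by rewrite mul1r (negPf xD).
split; first by rewrite -[y]mul1r; apply: vy => a /JC[aD _]; rewrite mul1r.
by rewrite mulrC; apply: vy => a /JC[_]; rewrite mulrC.
Qed.

(** This is the equality of [D] with the intersection of its localizations at t-maximal ideals. *)
Lemma dom_intersection (x : K) : (forall M, t_maximal M ->
    exists2 t : D, ~ M t%:F & t%:F * x \in dom_pred D) -> x \in dom_pred D.
Proof.
move=> H; apply/negPn/negP => /conductor_proper_t/t_maximal_above[M tM CM].
have [t Mt tx] := H M tM; apply: Mt; apply: CM; split=> //.
exact: tofrac_dom.
Qed.

Lemma conductor_maximal (M : set K) x : t_maximal M -> x \notin dom_pred D ->
  (forall y, M y -> x * y \in dom_pred D) -> conductor x = M.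
Proof.
move=> tM xD xM; case: (tM) => _ Mmax; apply: Mmax; first exact: conductor_proper_t.
have [_ _ MD _ _] := t_maximal_props tM.
by move=> y My; split; [rewrite -domE; apply: MD|rewrite mulrC xM].
Qed.

Lemma t_maximal_neq (M M' : set K) : t_maximal M -> t_maximal M' -> M <> M' ->
  exists2 c, M c & ~ M' c.
Proof.
move=> [pM Mmax] [pM' _] ne; apply: contrapT => no; apply/ne/esym/Mmax => // c Mc.
by apply: contrapT => M'c; apply: no; exists c.
Qed.

Lemma t_maximalM (M : set K) x y : t_maximal M -> x \in dom_pred D -> y \in dom_pred D ->
  M (x * y) -> M x \/ M y.
Proof.
move=> /t_maximal_prime[p ->] /domP[a ->] /domP[b ->].
rewrite -tofracM !dom_ideal_tofrac prime_idealrM => /orP[]; by [left|right].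
Qed.

Lemma ideal_prod_inv_dom (I : set K) : ideal_prod (ideal_inv I) I `<=` dom D.
Proof.
move=> z zP; rewrite domE -[z]mul1r; apply: (span_dom_mul _ zP) => _ [x [y [xI Iy ->]]].
by rewrite mul1r -domE; apply: xI.
Qed.

Lemma sub_ideal_prod_inv (I : set K) : I `<=` dom D -> I `<=` ideal_prod (ideal_inv I) I.
Proof.
move=> ID x Ix; apply: span_dom_gen; exists 1, x; split=> //; last by rewrite mul1r.
by move=> y /ID; rewrite mul1r.
Qed.

Lemma ideal_prod_inv_nonzero (I : set K) : I `<=` dom D -> nonzero I ->
  nonzero (ideal_prod (ideal_inv I) I).
Proof. by move=> ID [x Ix x0]; exists x => //; apply: sub_ideal_prod_inv. Qed.

Lemma inv_anti (I J : set K) : I `<=` J -> ideal_inv J `<=` ideal_inv I.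
Proof. by move=> IJ x xJ y /IJ/xJ. Qed.

(** For the product J of [I] and its inverse, J_t is a v-ideal, so it contains J_v = D. *)
Lemma TV_H : TV_domain D -> H_domain D.
Proof.
move=> TV I [sI ID] nI vI; set J := ideal_prod (ideal_inv I) I.
have sJ : submodule J := span_submodule _.
have JD : J `<=` dom D := @ideal_prod_inv_dom I.
have nJ : nonzero J := ideal_prod_inv_nonzero ID nI.
have [_ _ TE] := TV _ (tclosure_t_ideal sJ nJ JD).
apply: ideal_eq_dom; [exact: tclosure_submodule|exact: tclosure_dom|].
rewrite TE; have : vclosure J 1 by rewrite -/(v_invertible I) vI domE rpred1.
by apply: inv_anti; apply: inv_anti; apply: sub_tclosure.
Qed.

(** * Finite t-character of TV domains *)

Section FiniteCharacter.
Hypothesis TV : TV_domain D.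

Lemma TV_inverse (M : set K) : t_maximal M ->
  exists2 x, x \notin dom_pred D & forall y, M y -> x * y \in dom_pred D.
Proof.
move=> tM; have [_ _ _ M1 _] := t_maximal_props tM; apply: contrapT => no; apply: M1.
have [[tI _ _] _] := tM; have [_ _ ->] := TV tI.
move=> x xM; rewrite mul1r domE; apply/negPn/negP => xD; apply: no; exists x => //.
by move=> y /xM; rewrite domE.
Qed.

Variables (d : D) (d0 : d != 0).
Definition t_max_containing : set (set K) := [set M | t_maximal M /\ M d%:F].

Lemma prime_avoid (M : set K) (l : seq (set K)) : t_maximal M ->
  (forall N, N \in l -> t_maximal N /\ N <> M) ->
  exists y, [/\ y \in dom_pred D, ~ M y & forall N, N \in l -> N y].
Proof.
move=> tM; have [_ _ _ M1 _] := t_maximal_props tM.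
elim: l => [|N l IH] lP; first by exists 1; rewrite rpred1.
have [N' N'l|y [yD My yl]] := IH; first by apply: lP; rewrite inE N'l orbT.
have [tN NM] := lP N (mem_head _ _); have [c Nc Mc] := t_maximal_neq tN tM NM.
have [_ _ ND _ _] := t_maximal_props tN.
have cD : c \in dom_pred D by rewrite -domE; apply: ND.
exists (c * y); split; first exact: rpredM.
  by move=> /(t_maximalM tM cD yD)[].
move=> N'; rewrite inE => /predU1P[->|N'l].
  have [[_ _ NM'] _ _ _ _] := t_maximal_props tN.
  by rewrite mulrC; have /domP[b ->] := yD; apply: NM'.
have [tN' _] : t_maximal N' /\ N' <> M by apply: lP; rewrite inE N'l orbT.
have [[_ _ NM'] _ _ _ _] := t_maximal_props tN'.
by have /domP[b ->] := cD; apply: NM'; apply: yl.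
Qed.

(* The union of the inverses of the finite intersections of the other t-maximal
   ideals containing d is a t-ideal, hence a v-ideal, which forces the conclusion. *)
Lemma TV_separation (M : set K) : t_max_containing M ->
  exists x, [/\ x \in dom_pred D, ~ M x
    & forall N, t_max_containing N -> N <> M -> N x].
Proof.
move=> [tM Md]; apply: contrapT => no.
have [x0 x0D x0M] := TV_inverse tM.
pose G := [set N | t_max_containing N /\ N <> M].
pose F := [set z : K | exists2 l : seq (set K), forall N, N \in l -> G N &
  forall w, w \in dom_pred D -> (forall N, N \in l -> N w) -> w * z \in dom_pred D].
have F1 : F 1 by exists [::] => // w wD _; rewrite mulr1.
have sF : submodule F.
  split.
  - by exists [::] => // w wD _; rewrite mulr0 rpred0.
  - move=> x y [l lG lx] [l' l'G l'y]; exists (l ++ l').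
      by move=> N; rewrite mem_cat => /orP[/lG|/l'G].
    move=> w wD wl; rewrite mulrDr rpredD //.
      by apply: lx => // N Nl; apply: wl; rewrite mem_cat Nl.
    by apply: l'y => // N Nl; apply: wl; rewrite mem_cat Nl orbT.
  - move=> a x [l lG lx]; exists l => // w wD wl.
    by rewrite mulrCA rpredM ?tofrac_dom ?lx.
(* The common element [d] of the ideals in [G] is what makes [F] fractional. *)
have dF x : F x -> d%:F * x \in dom_pred D.
  move=> [l lG lx]; apply: lx; first exact: tofrac_dom.
  by move=> N /lG[[_ Nd] _].
have nF : nonzero F by exists 1; rewrite ?oner_neq0.
have tF : t_ideal F.
  split=> //.
    by split=> //; exists d => // x /dF; rewrite domE.
  apply/seteqP; split; first exact: sub_tclosure.
  move=> x /(tclosureP _ sF)[J [_ JF vx]].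
  have [l lG lJ] : exists2 l : seq (set K), forall N, N \in l -> G N &
      forall w, w \in dom_pred D -> (forall N, N \in l -> N w) ->
      forall a, a \in J -> w * a \in dom_pred D.
    elim: J JF {vx} => [|b J IH] JF; first by exists [::].
    have [a aJ|l lG lJ] := IH; first by apply: JF; rewrite inE aJ orbT.
    have [l' l'G l'b] := JF b (mem_head _ _); exists (l ++ l').
      by move=> N; rewrite mem_cat => /orP[/lG|/l'G].
    move=> w wD wl a; rewrite inE => /predU1P[->|aJ].
      by apply: l'b => // N Nl; apply: wl; rewrite mem_cat Nl orbT.
    by apply: lJ => // N Nl; apply: wl; rewrite mem_cat Nl.
  by exists l => // w wD wl; apply: vx; apply: lJ.
have [_ _ FE] := TV tF.
(* An element [w] of the inverse of [F] is in [D], since 1 is in [F], and in every [N] of [G], since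
   the inverse of [N] is in [F]. By assumption it is then in [M], so w x0 is in [D]; thus x0 is in
   F_v = F. *)
have : F x0.
  rewrite FE => w wF; rewrite domE; apply: x0M; apply: contrapT => Mw.
  have wD : w \in dom_pred D by rewrite -domE -[w]mulr1; apply: wF.
  apply: no; exists w; split=> // N GN NM; have [tN Nd] := GN.
  have [xN xND xNN] := TV_inverse tN.
  rewrite -(conductor_maximal tN xND xNN); split=> //; rewrite -domE; apply: wF.
  exists [:: N] => [N'|y yD yN]; first by rewrite inE => /eqP ->.
  by rewrite mulrC; apply: xNN; apply: yN; rewrite inE.
move=> [l lG lx0].
(* Membership of x0 in [F] involves finitely many ideals; some [y] lies in all of them but not in
   [M], although y x0 in [D] forces [y] into [M]. *)
have [N /lG[[tN _] NM]|y [yD My yl]] := @prime_avoid M l tM; first by [].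
apply: My; rewrite -(conductor_maximal tM x0D x0M); split=> //.
exact: lx0.
Qed.

(** The elements avoided by only finitely many t-maximal ideals over [d] form an ideal [J]. It
    contains [d] and an element outside each such ideal, so J_t = D; a finite part of [J] with 1 in
    its v-closure is contained in no t-maximal ideal, so only finitely many exist over [d]. *)
Lemma TV_finite_character : finite_set t_max_containing.
Proof.
pose J := [set x : K | x \in dom_pred D /\
  finite_set [set M | t_max_containing M /\ ~ M x]].
have MA (M : set K) : t_max_containing M -> submodule M.
  by move=> [/t_maximal_props[]].
have sJ : submodule J.
  split.
  - split; first exact: rpred0.
    by apply: sub_finite_set (finite_set0 _) => M [/MA[M0 _ _]] /(_ M0).
  - move=> x y [xD xf] [yD yf]; split; first exact: rpredD.
    have : finite_set ([set M | t_max_containing M /\ ~ M x] `|`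
                       [set M | t_max_containing M /\ ~ M y]) by rewrite finite_setU.
    apply: sub_finite_set => M [cM Mxy].
    have [_ MD _] := MA M cM.
    have [Mx|Mx] := pselect (M x); last by left.
    by right; split=> // My; apply: Mxy; apply: MD.
  - move=> a x [xD xf]; split; first by rewrite rpredM ?tofrac_dom.
    apply: sub_finite_set xf => M [cM Max]; split=> // Mx; apply: Max.
    by have [_ _ MM] := MA M cM; apply: MM.
have JD : J `<=` dom D by move=> x [xD _]; rewrite domE.
have Jd : J d%:F.
  split; first exact: tofrac_dom.
  by apply: sub_finite_set (finite_set0 _) => M [[_ Md]] /(_ Md).
have nJ : nonzero J by exists d%:F; rewrite ?tofrac_eq0.
have TJ : tclosure J 1.
  apply: contrapT => J1; have pT : proper_t_ideal (tclosure J).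
    split; [exact: tclosure_t_ideal|exact: tclosure_dom|].
    by move=> TE; apply: J1; rewrite TE domE rpred1.
  have [M tM TM] := t_maximal_above pT.
  have JM : J `<=` M by move=> x Jx; apply/TM/sub_tclosure.
  have cM : t_max_containing M by split=> //; apply: JM.
  have [x [xD Mx xN]] := TV_separation cM; apply/Mx/JM; split=> //.
  apply: sub_finite_set (finite_set1 M) => N [cN Nx]; apply: contrapT => NM.
  by apply: Nx; apply: xN.
have [T [nT TJ' v1]] := (tclosureP _ sJ).1 TJ.
have : finite_set [set M | t_max_containing M /\ exists2 a, a \in T & ~ M a].
  elim: T TJ' {nT v1} => [|b T IH] TJ'.
    by apply: sub_finite_set (finite_set0 _) => M [_ []].
  have [_ bf] := TJ' b (mem_head _ _).
  have IH' : finite_set [set M | t_max_containing M /\ exists2 a, a \in T & ~ M a].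
    by apply: IH => a aT; apply: TJ'; rewrite inE aT orbT.
  have : finite_set ([set M | t_max_containing M /\ ~ M b] `|`
      [set M | t_max_containing M /\ exists2 a, a \in T & ~ M a]) by rewrite finite_setU.
  apply: sub_finite_set => M [cM [a]].
  rewrite inE => /predU1P[->|aT] Ma; first by left.
  by right; split=> //; exists a.
apply: sub_finite_set => M cM; split=> //; apply: contrapT => no.
have [_ _ _ M1 Mt] := t_maximal_props cM.1; apply: M1; apply: Mt nT _ v1.
by move=> a aT; apply: contrapT => Ma; apply: no; exists a.
Qed.

End FiniteCharacter.

Lemma local_polyOver_denominator (p : prime_idealr D) (g : {poly K}) :
  g \is a polyOver (local_pred p) ->
  exists2 s, s \notin p & s%:F *: g \is a polyOver (dom_pred D).
Proof.
move=> /polyOverP gp.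
have [s sp sP] : exists2 s, s \notin p & forall n, (n < size g)%N ->
    s%:F * g`_n \in dom_pred D.
  elim: (size g) => [|n [s sp sP]]; first by exists 1; rewrite ?idealr1.
  have /dom_atP[b [t [tp e]]] := gp n.
  exists (s * t) => [|m]; first exact: notin_primeM.
  rewrite ltnS leq_eqVlt tofracM => /predU1P[->|/sP mD].
    rewrite e -mulrA [t%:F * _]mulrC divfK; last by rewrite tofrac_eq0 (prime_neq0 tp).
    by rewrite -tofracM tofrac_dom.
  by rewrite mulrAC rpredM // tofrac_dom.
exists s => //; apply/polyOverP => n; rewrite coefZ.
have [/sP//|gn] := ltnP n (size g).
by rewrite nth_default // mulr0 rpred0.
Qed.

(* Powers of an element a of m outside p have a Vandermonde determinant
   a power of a times an element outside m. *)
Lemma int_outside_prime (p m : prime_idealr D) (f : {poly K}) (a : D) :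
  a \in m -> a \notin p -> (forall b : D, f.[b%:F] \in local_pred p) ->
  exists s, s \notin p /\ exists2 t, t \notin m &
    forall b : D, t%:F * (s%:F * f.[b%:F]) \in dom_pred D.
Proof.
move=> am ap fp; pose n := size f.
have [M [t [tm e]]] := vandermonde_powers n am.
have := @vandermonde_scale _ (local_pred p) n f (fun i => (a ^+ i)%:F) (leqnn _).
have -> : \prod_(i < n) \prod_(j < n | (i < j)%N) ((a ^+ j)%:F - (a ^+ i)%:F) =
    (a ^+ M * t)%:F :> K.
  rewrite -e rmorph_prod; apply: eq_bigr => i _; rewrite rmorph_prod.
  by apply: eq_bigr => j _; rewrite rmorphB.
move=> /(_ (fun i => tofrac_local_proof p _) (fun i => fp _)).
move=> /local_polyOver_denominator[s sp sg].
exists (s * a ^+ M); split.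
  apply: notin_primeM => //; elim: M {e sg} => [|M IH]; first by rewrite idealr1.
  by rewrite exprS notin_primeM.
exists t => // b.
have -> : t%:F * ((s * a ^+ M)%:F * f.[b%:F]) =
    (s%:F *: ((a ^+ M * t)%:F *: f)).[b%:F].
  by rewrite !hornerZ !tofracM; ring.
exact: (@rpred_horner _ (dom_pred D) _ _ sg (tofrac_dom b)).
Qed.

(** A common denominator [d] of the coefficients settles all t-maximal ideals not containing it. The
    finitely many others each supply a factor outside [p], and the product of these makes [f]
    integral in every localization, hence in [D]. *)
Lemma finite_character_Int (p : prime_idealr D) :
  (forall d : D, d != 0 -> finite_set (t_max_containing d)) ->
  Int_commutes_loc (compl p).
Proof.
move=> fin; apply/seteqP; split; last exact/localize_IntD_sub/compl_mult.
move=> f fI.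
have fp (b : D) : f.[b%:F] \in local_pred p.
  by apply/dom_at_local/fI/dom_at_local/tofrac_local_proof.
have [d d0 dP] := common_denominator f.
have df (b : D) : d%:F * f.[b%:F] \in dom_pred D.
  rewrite -hornerZ; suff H : d%:F *: f \is a polyOver (dom_pred D).
    exact: (@rpred_horner _ (dom_pred D) _ _ H (tofrac_dom b)).
  apply/polyOverP => n; rewrite coefZ.
  have [nf|nf] := ltnP n (size f); first exact/dP/mem_nth.
  by rewrite nth_default // mulr0 rpred0.
have /finite_seqP[l lE] := fin d d0.
have /choice[F FP] : forall M : set K, exists s : D, s \notin p /\ (t_maximal M ->
    forall b : D, exists2 t, ~ M t%:F & t%:F * (s%:F * f.[b%:F]) \in dom_pred D).
  move=> M; have [tM|] := pselect (t_maximal M); last by exists 1; rewrite idealr1.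
  have [m ME] := t_maximal_prime tM.
  have [[a am ap]|no] := pselect (exists2 a, a \in m & a \notin p).
    have [s [sp [t tm sf]]] := int_outside_prime am ap fp; exists s; split=> // _ b.
    by exists t => //; rewrite ME dom_ideal_tofrac; apply/negP.
  (* Here [m] is contained in [p], so a denominator outside [p] is also outside [m]. *)
  exists 1; split=> [|_ b]; first by rewrite idealr1.
  have /dom_atP[c [t [tp ->]]] := fp b; exists t.
    rewrite ME dom_ideal_tofrac => tm; apply: no; exists t => //.
  by rewrite tofrac1 mul1r mulrC divfK ?tofrac_dom // tofrac_eq0 (prime_neq0 tp).
have sp : \prod_(M <- l) F M \notin p by apply: notin_prime_prod => M _; case: (FP M).
set s := \prod_(M <- l) F M in sp.
have s0 : s%:F != 0 :> K by rewrite tofrac_eq0 (prime_neq0 sp).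
exists s, (s%:F *: f); split=> //; last by rewrite scalerA mulVf // scale1r.
apply/IntDE => b; rewrite hornerZ; apply: dom_intersection => M tM.
have [Md|Md] := pselect (M d%:F); last first.
  by exists d => //; rewrite mulrCA rpredM ?tofrac_dom.
have [_ /(_ tM b)[t Mt tf]] := FP M; exists t => //.
have Ml : M \in l by have : t_max_containing d M by []; rewrite lE.
rewrite /s (big_rem M) //= tofracM (_ : _ * _ = (\prod_(N <- rem M l) F N)%:F *
  (t%:F * ((F M)%:F * f.[b%:F]))); last by ring.
by rewrite rpredM ?tofrac_dom.
Qed.

(** For x = a/b the ideal (a, b) is t-invertible, so some [y] in its inverse takes [a] or [b]
    outside [p]; the fraction ya/yb then has numerator or denominator outside [p]. *)
Lemma PVMD_valuation (p : prime_idealr D) (x : K) : PVMD D ->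
  t_maximal (dom_ideal p) -> x \in local_pred p \/ x^-1 \in local_pred p.
Proof.
move=> pvmd tp; have [a [b [b0 ->]]] := frac_dom x.
have bF0 : b%:F != 0 :> K by rewrite tofrac_eq0.
set I := @Defs.span K K^o (dom D) [set` [:: a%:F; b%:F]].
have Ia : I a%:F by apply: span_dom_gen; rewrite /= inE eqxx.
have Ib : I b%:F by apply: span_dom_gen; rewrite /= !inE eqxx orbT.
have ID : I `<=` dom D.
  move=> z zI; rewrite domE -[z]mul1r; apply: (span_dom_mul _ zI) => c /=.
  by rewrite mul1r 2!in_cons in_nil orbF => /orP[]/eqP->; apply: tofrac_dom.
have nI : nonzero I by exists b%:F.
have /= tI := pvmd I (conj (span_submodule _) ID) nI (ex_intro _ _ erefl).
have [sM _ _ M1 _] := t_maximal_props tp.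
have [y [yI My]] : exists y, ideal_inv I y /\
    (~ dom_ideal p (y * a%:F) \/ ~ dom_ideal p (y * b%:F)).
  apply: contrapT => no; apply: M1.
  have : tclosure (ideal_prod (ideal_inv I) I) 1 by rewrite tI domE rpred1.
  apply: (tclosure_sub_maximal tp (span_submodule _)).
  apply: (@span_min K K^o (dom D)); first exact: submodule_is_submod.
  move=> _ [y [z [yI zI ->]]].
  pose N : set K^o := [set z | dom_ideal p (y * z)].
  suff : I `<=` N by apply.
  have [M0 MD MM] := sM; apply: (@span_min K K^o (dom D)).
    rewrite /N; split=> /= [|u v Nu Nv|_ v [c _ <-] Nv].
    - by rewrite mulr0.
    - by rewrite mulrDr; apply: MD.
    - by rewrite /GRing.scale /= mulrCA; apply: MM.
  move=> c /=; rewrite !inE => /orP[]/eqP->; apply: contrapT => H; apply: no;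
    exists y; split=> //.
    by left.
  by right.
have /domP[c yc] : y * a%:F \in dom_pred D by rewrite -domE; apply: yI.
have /domP[e ye] : y * b%:F \in dom_pred D by rewrite -domE; apply: yI.
have y0 : y != 0.
  apply/eqP => y0; have [M0 _ _] := sM.
  by case: My; rewrite y0 mul0r.
have abE : a%:F / b%:F = c%:F / e%:F by rewrite -yc -ye -mulf_div mulfV // mul1r.
case: My; rewrite ?yc ?ye dom_ideal_tofrac => /negP H; [right|left]; apply/dom_atP.
  by exists e, c; rewrite abE invf_div.
by exists c, e.
Qed.

(** If the inverse of [M] were D, then [M] would be v-invertible, hence t-invertible, giving M_t =
    D. *)
Lemma H_inverse (M : set K) : H_domain D -> t_maximal M ->
  exists2 x, x \notin dom_pred D & forall y, M y -> x * y \in dom_pred D.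
Proof.
move=> H tM; have [sM nM MD M1 _] := t_maximal_props tM.
apply: contrapT => no; apply: M1.
have invM : ideal_inv M `<=` dom D.
  move=> x xM; rewrite domE; apply/negPn/negP => xD; apply: no; exists x => //.
  by move=> y /xM; rewrite domE.
set J := ideal_prod (ideal_inv M) M.
have JM : J `<=` M.
  apply: (@span_min K K^o (dom D)); first exact: submodule_is_submod.
  move=> _ [x [y [/invM[a _ <-] My ->]]].
  by have [_ _ MM] := sM; apply: MM.
have MJ : M `<=` J := sub_ideal_prod_inv MD.
have : tclosure J = dom D.
  apply: H => //; apply/seteqP; split=> x.
    move=> xJ; rewrite -[x]mulr1; apply: xJ => y Jy.
    by rewrite mul1r; apply/MD/JM.
  rewrite domE => xD y yJ; rewrite domE rpredM // -domE; apply: invM.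
  by move=> z /MJ/yJ.
move=> TJ; apply: (tclosure_sub_maximal tM (span_submodule _) JM).
by rewrite TJ domE rpred1.
Qed.

Lemma H_PVMD_principal (p : prime_idealr D) : H_PVMD D -> t_maximal (dom_ideal p) ->
  exists a, max_set p = @Defs.span _ {fraction D}^o (dom_at p) [set a].
Proof.
move=> [pvmd H] tp; have [x xD xM] := H_inverse H tp.
have xp b : b \in p -> exists e : D, x * b%:F = e%:F.
  by move=> bp; apply/domP/xM/dom_ideal_tofrac.
(* If xc = t is outside [p], then any [b] in [p] equals (xb/t)c, so [c] generates pD_p. The
   remaining case, xp contained in [p], is contradictory. *)
have [[c cp xc]|no] := pselect (exists2 c, c \in p & ~ dom_ideal p (x * c%:F)).
  have [t xct] := xp c cp; move: xc; rewrite xct dom_ideal_tofrac => /negP tn.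
  exists c%:F; apply/seteqP; split.
    move=> _ /max_setP[b [s [bp sp ->]]]; have [e xbe] := xp b bp.
    rewrite (_ : _ / _ = (e%:F / (t * s)%:F) * c%:F).
      have [_ _ SZ] : @is_submod K K^o (dom_at p) (@Defs.span K K^o (dom_at p) [set c%:F]).
        by apply: span_is_submod => u v; rewrite dom_atE; apply: rpredM.
      apply: SZ.
        by rewrite dom_atE; apply/dom_atP; exists e, (t * s); rewrite notin_primeM.
      by apply: (@span_gen K K^o) => //; rewrite dom_atE /= rpred1.
    have s0 : s%:F != 0 :> K by rewrite tofrac_eq0 (prime_neq0 sp).
    have t0 : t%:F != 0 :> K by rewrite tofrac_eq0 (prime_neq0 tn).
    rewrite tofracM mulrAC; apply/eqP; rewrite eqr_div ?mulf_neq0 //.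
    by rewrite mulrA -xct -xbe -!mulrA [c%:F * _]mulrC mulrCA.
  apply: (@span_min K K^o).
    by apply: span_is_submod => u v; rewrite dom_atE; apply: rpredM.
  move=> _ ->; apply/max_setP; exists c, 1; by rewrite idealr1 tofrac1 divr1.
(* At every t-maximal ideal other than [p], an element of [p] outside it is a denominator of [x]; if
   [x] were also in D_p it would be in [D]. *)
have xloc : x \notin local_pred p.
  apply: contra xD => /dom_atP[b [t [tn xE]]]; apply: dom_intersection => M tM.
  have [<-|/(t_maximal_neq tp tM)[c pc Mc]] := pselect (dom_ideal p = M).
    exists t; first by move=> /dom_ideal_tofrac; apply/negP.
    by rewrite xE mulrC divfK ?tofrac_dom // tofrac_eq0 (prime_neq0 tn).
  have [c' _ cE] := pc; exists c'; first by rewrite cE.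
  by rewrite cE mulrC xM.
have [|/dom_atP[b [t [tn xE]]]] := PVMD_valuation x pvmd tp; first by rewrite (negPf xloc).
(* The inverse of [x] is in D_p, so [t] is outside [p] while [b] must be in [p]; then xb = t
   contradicts xp being contained in [p]. *)
have xE' : x = t%:F / b%:F by rewrite -[x]invrK xE invf_div.
have bp : b \in p.
  by apply: contraNT xloc => bn; apply/dom_atP; exists t, b.
have b0 : b%:F != 0 :> K.
  apply: contraNneq xloc => b0; rewrite xE' b0 invr0 mulr0; exact: rpred0.
case/negP: tn; rewrite -dom_ideal_tofrac; apply: contrapT => tM; apply: no.
by exists b => //; rewrite xE' divfK.
Qed.

Lemma H_PVMD_standing : H_PVMD D ->
  (forall p : prime_idealr D, Int_commutes_loc (compl p)) -> standing_hyp D.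
Proof. by move=> H Ic p tp _; split; [exact: H_PVMD_principal|exact: Ic]. Qed.

Lemma TV_Int_commutes (p : prime_idealr D) : TV_domain D -> Int_commutes_loc (compl p).
Proof.
by move=> TV; apply: finite_character_Int => d d0; apply: TV_finite_character.
Qed.

End TMaximal.

Theorem theorem1p2 (D : idomainType) (D_inf : infinite_set [set: D]) :
  [/\ TV_PVMD D ->
       [/\ H_PVMD D,
           forall p : prime_idealr D, Int_commutes_loc (compl p)
         & standing_hyp D],
      H_PVMD D ->
        (forall p : prime_idealr D, Int_commutes_loc (compl p)) ->
        standing_hyp D
    & standing_hyp D ->
      [/\ locally_free (IntD D),
          forall S : set D, mult_subset S -> Int_commutes_loc S,
          forall (A : idomainType) (phi : {rmorphism D -> A})
            (phi_inj : injective phi),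
            t_linked phi_inj -> polynomially_regular phi_inj
        & forall (A : idomainType) (phi : {rmorphism D -> A})
            (phi_inj : injective phi),
            t_linked phi_inj ->
            (polynomially_complete phi_inj <->
             forall p : prime_idealr D,
               t_maximal (dom_ideal p) -> finite_residue p ->
               unramified_at phi_inj p /\ trivial_residue_at phi_inj p)]].
Proof.
split=> [[pvmd TV]|H Ic|hyp].
- have HD : H_PVMD D by split=> //; apply: TV_H.
  have Ic (p : prime_idealr D) : Int_commutes_loc (compl p) by apply: TV_Int_commutes.
  by split=> //; apply: H_PVMD_standing.
- exact: H_PVMD_standing.
split=> [|S mS|A phi phi_inj tl|A phi phi_inj tl].
- exact: IntD_locally_free.
- exact: Int_commutes_loc_all.
- exact: t_linked_regular.
- exact: t_linked_complete.
Qed.
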